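(* Let $n\ge 2$, let $M=\mathbb R^n$ with its standard orientation and metric, and let $\mathfrak g$ be the Lie algebra of Killing fields on $\mathbb R^n$. Let $\Sigma$ be a simply-connected oriented $(n-1)$-dimensional manifold, and let $A$ be a Lie algebroid over $\Sigma$ with $\operatorname{rank}A=(n+2)(n-1)/2$. Then any infinitesimal immersion $\omega\colon A\to\mathfrak g$ of $\Sigma$ into $M$ has, as primitive, an immersion $f\colon\Sigma\to\mathbb R^n$ whose first fundamental form (inherited metric) and second fundamental form are $\langle\!\langle\cdot,\cdot\rangle\!\rangle_\omega$ and $\mathrm{I\!I}_\omega$. The immersion $f$ is unique up to orientation-preserving isometries of $\mathbb R^n$.
   Context: $M=\mathbb R^n$ is acted on transitively by the group $G=\mathrm{SO}(n)\ltimes\mathbb R^n$ of orientation-preserving isometries; the Lie algebra $\mathfrak g$ of $G$ (bracket defined by right-invariant vector fields) is identified with the Killing fields on $M$ with the vector field bracket. For $m\in M$, $\mathfrak g_m=\{\xi\in\mathfrak g:\xi(m)=0\}$. Infinitesimal immersion. Let $A$ be a Lie algebroid over the connected manifold $\Sigma$ with anchor $\#\colon A\to T\Sigma$. A Lie algebroid morphism $\omega\colon A\to\mathfrak g$ is an infinitesimal immersion of $\Sigma$ into $M$ if: (I1) $A$ is transitive ($\#$ is onto); (I2) $\omega$ is injective on fibres; (I3) for some (equivalently any) $x_0\in\Sigma$ there is $m_0\in M$ with $\omega(\ker\#|_{x_0})\subset\mathfrak g_{m_0}$; (I4) $\dim\mathfrak g-\operatorname{rank}A=\dim M-\dim\Sigma$.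 One then has $\omega(\ker\#|_{x_0})=\mathfrak g_{m_0}$ in (I3). Using $\omega$, regard $A$ as a subbundle of the trivial bundle $E=\mathfrak g\times\Sigma$; $\nabla$ is the canonical flat connection on $E$; $\mathfrak h=\ker\#\subset A\subset E$. Since $A/\mathfrak h\cong T\Sigma$, $T\Sigma$ is a subbundle of $E/\mathfrak h$. Logarithmic derivative and primitives. For an immersion $f\colon\Sigma\to M$, $A(f)=\{(\xi,x)\in E:\xi(f(x))\in T_xf(T_x\Sigma)\}$, with anchor sending $(\xi,x)$ to the $u\in T_x\Sigma$ with $Tf(u)=\xi(f(x))$, and bracket $[X,Y]=\nabla_{\#X}Y-\nabla_{\#Y}X+\{X,Y\}$, where $\{X,Y\}(x)=[X(x),Y(x)]_{\mathfrak g}$; this is a Lie algebroid. The logarithmic derivative $\delta f\colon A(f)\to\mathfrak g$ is $(\xi,x)\mapsto\xi$. The map $f$ is a primitive of $\omega$ if there are a Lie algebroid morphism $\lambda\colon A\to A(f)$ covering $\mathrm{id}_\Sigma$ and $l\in G$ with $\delta f\circ\lambda=\mathrm{Ad}_l\circ\omega$. Fundamental forms of $\omega$. Let $\mathfrak r\subset\mathfrak g$ be the ideal of constant vector fields (this is $\operatorname{rad}\mathfrak g$ if $n\ge3$ and $[\mathfrak g,\mathfrak g]$ if $n=2$), and let $Q$ be the inner product on $\mathfrak r\cong\mathbb R^n$ given by the standard one; it is $\mathrm{Ad}$-invariant and defines an inner product $Q$ on $\mathfrak r\times\Sigma\subset E$. The projection $E\to E/\mathfrak h$ restricts to an isomorphism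 $\mathfrak r\times\Sigma\to E/\mathfrak h$, pushing $Q$ to an inner product on $E/\mathfrak h$; its restriction to $T\Sigma$ is the first fundamental form $\langle\!\langle\cdot,\cdot\rangle\!\rangle_\omega$ of $\omega$. The bundle $E/\mathfrak h$ is oriented as follows: for $x\in\Sigma$, $\omega(\mathfrak h|_x)=\mathfrak g_m$ for some $m\in M$, and $(E/\mathfrak h)|_x\cong\mathfrak g/\mathfrak g_m\cong T_mM$ via $\xi\mapsto\xi(m)$; transfer the orientation of $M$. The normal $\xi$ of $\omega$ is the unique section of $\mathfrak r\times\Sigma$ that is $Q$-orthogonal to $A\cap(\mathfrak r\times\Sigma)$ (a subbundle of corank one in $\mathfrak r\times\Sigma$), has $Q(\xi,\xi)=1$, and whose image $\bar\xi$ in $E/\mathfrak h$ is transverse to $T\Sigma$ with direction consistent with the orientations: $(v_1,\dots,v_{n-1},\bar\xi)$ is positively oriented in $E/\mathfrak h$ for every positively oriented basis $(v_i)$ of $T_x\Sigma$. One has $\nabla_u\xi\in A$ for $u\in T\Sigma$, and the second fundamental form of $\omega$ is $\mathrm{I\!I}_\omega(u,v)=-\langle\!\langle\#\nabla_u\xi,v\rangle\!\rangle_\omega$. The second fundamental form of an immersion $f$ is taken with respect to the unit normal $\mathbf n$ such that $(Tf(v_1),\dots,Tf(v_{n-1}),\mathbf n)$ is positively oriented whenever $(v_i)$ is, i.e. $\mathrm{I\!I}(u,v)=\langle\!\langle\nabla^M_u v,\mathbf n\rangle\!\rangle$, with $\nabla^M$ the (pulled back) Levi-Civita connection of $M$.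 *)

(* Defs.v *)
From HB Require Import structures.
From mathcomp Require Import all_boot all_order all_algebra.
From mathcomp Require Import all_classical all_reals all_analysis.

Set Implicit Arguments.
Unset Strict Implicit.
Unset Printing Implicit Defensive.

Import Order.TTheory GRing.Theory Num.Theory.
Import numFieldNormedType.Exports.

Local Open Scope classical_set_scope.
Local Open Scope ring_scope.

(** * Smooth maps between Euclidean spaces *)

(* Only meant for an open set U: the derivatives at a point of U then depend
   on the restriction of f to U alone. *)
Fixpoint Ck (R : realType) (E W : normedModType R) (k : nat) (U : set E)
    (f : E -> W) : Prop :=
  if k is k'.+1 then
    (forall x, U x -> differentiable f x) /\ (forall v, Ck k' U ('D_v f))
  else forall x, U x -> {for x, continuous f}.

Definition Csmooth (R : realType) (E W : normedModType R) (U : set E)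
  (f : E -> W) : Prop := forall k, Ck k U f.

Definition dot (R : realType) (n : nat) (u v : 'rV[R]_n) : R :=
  \sum_(i < n) u 0 i * v 0 i.

(** * Smooth manifolds *)

(* A second countable Hausdorff space with a smooth atlas.  [chart i] and
   [cinv i] are total functions that are mutually inverse homeomorphisms between
   [cdom i] and its image.  Each point x has a preferred chart [chart_at x];
   it serves to identify the tangent space at x with R^d, so that below a
   tangent vector at x is an element of 'rV[R]_d, namely its coordinates in the
   chart [chart_at x]. *)
Record manifold (R : realType) (d : nat) := Manifold {
  space :> topologicalType ;
  mf_hausdorff : hausdorff_space space ;
  mf_second_countable : @second_countable space ;
  chart_ix : Type ;
  cdom : chart_ix -> set space ;
  chart : chart_ix -> space -> 'rV[R]_d ;
  cinv : chart_ix -> 'rV[R]_d -> space ;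
  chart_at : space -> chart_ix ;
  cdom_at : forall x, cdom (chart_at x) x ;
  cdom_open : forall i, open (cdom i) ;
  cimg_open : forall i, open (chart i @` cdom i) ;
  chartK : forall i x, cdom i x -> cinv i (chart i x) = x ;
  chart_continuous : forall i x, cdom i x -> {for x, continuous (chart i)} ;
  cinv_continuous : forall i y, (chart i @` cdom i) y ->
    {for y, continuous (cinv i)} ;
  chart_smooth : forall i j,
    Csmooth (chart i @` (cdom i `&` cdom j)) (chart j \o cinv i) }.

Section Calculus.
Variables (R : realType) (d : nat) (S : manifold R d).

Definition smooth_on (W : normedModType R) (U : set S) (F : S -> W) : Prop :=
  forall i, Csmooth (chart i @` (cdom i `&` U)) (F \o cinv (m:=S) i).

(* The differential of F at x applied to the tangent vector u. *)
Definition tder (W : normedModType R) (x : S) (u : 'rV[R]_d) (F : S -> W) : W :=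
  'D_u (F \o cinv (m:=S) (chart_at x)) (chart (chart_at x) x).

(* The components of V in every chart are smooth. *)
Definition smooth_vfield (V : S -> 'rV[R]_d) : Prop :=
  forall i, smooth_on (cdom i) (fun x => tder x (V x) (chart (m:=S) i)).

Definition immersion (n : nat) (f : S -> 'rV[R]_n) : Prop :=
  smooth_on setT f /\ forall x u, tder x u f = 0 -> u = 0.

End Calculus.

Definition simply_connected (R : realType) (T : topologicalType) : Prop :=
  let I : set R := `[0, 1]%classic in
  [/\ [set: T] !=set0,
      (forall x y : T, exists g : R -> T,
        [/\ {within I, continuous g}, g 0 = x & g 1 = y])
    & (forall g : R -> T, {within I, continuous g} -> g 0 = g 1 ->
        exists H : R * R -> T,
          [/\ {within I `*` I, continuous H},
              (forall s, I s -> H (s, 0) = g s /\ H (s, 1) = g 0)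
            & (forall t, I t -> H (0, t) = g 0 /\ H (1, t) = g 0)])].

(* [osgn x] tells whether the standard basis of R^d, seen as a basis of the
   tangent space at x, is negatively oriented.  The last field says that the
   orientation it induces on the coordinates of each chart is locally
   constant. *)
Record orientation (R : realType) (d : nat) (S : manifold R d) := Orientation {
  osgn : S -> bool ;
  osgn_consistent :
    let s i y : R := (-1) ^+ osgn y *
      \det (\matrix_(k < d) tder y (delta_mx 0 k) (chart (m:=S) i)) in
    forall (i : chart_ix S) x, cdom i x -> \forall y \near x, 0 < s i y * s i x }.

Definition pos_basis (R : realType) (d : nat) (S : manifold R d)
    (o : orientation S) (x : S) (v : 'I_d -> 'rV[R]_d) : Prop :=
  0 < (-1) ^+ osgn o x * \det (\matrix_(k < d) v k) :> R.

(** * Lie algebroids *)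

(* Smooth vector bundles of rank r, given by an atlas of fibrewise linear
   trivializations with smooth transition functions. *)
Record vbundle (R : realType) (d : nat) (S : manifold R d) (r : nat) := VBundle {
  fib :> S -> lmodType R ;
  triv_ix : Type ;
  tdom : triv_ix -> set S ;
  triv : triv_ix -> forall x, {linear fib x -> 'rV[R]_r} ;
  tinv : triv_ix -> forall x, 'rV[R]_r -> fib x ;
  tdom_open : forall i, open (tdom i) ;
  tdom_cover : forall x, exists i, tdom i x ;
  trivK : forall i x, tdom i x -> cancel (triv i x) (tinv i x) ;
  tinvK : forall i x, tdom i x -> cancel (tinv i x) (triv i x) ;
  triv_smooth : forall i j v,
    smooth_on (tdom i `&` tdom j) (fun x => triv j x (tinv i x v)) }.

Definition smooth_section (R : realType) (d : nat) (S : manifold R d) (r : nat)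
    (A : vbundle S r) (X : forall x, A x) : Prop :=
  forall i, smooth_on (tdom i) (fun x => triv i x (X x)).

(* The bracket is only meaningful on smooth sections.  That the anchor is a
   morphism for the brackets follows from the Jacobi and Leibniz identities. *)
Record lieAlgebroid (R : realType) (d : nat) (S : manifold R d) (r : nat) :=
  LieAlgebroid {
  bundle :> vbundle S r ;
  anchor : forall x, {linear bundle x -> 'rV[R]_d} ;
  bracket : (forall x, bundle x) -> (forall x, bundle x) -> forall x, bundle x ;
  anchor_smooth : forall X, smooth_section X ->
    smooth_vfield (fun x => anchor x (X x)) ;
  bracket_smooth : forall X Y, smooth_section X -> smooth_section Y ->
    smooth_section (bracket X Y) ;
  bracket_alt : forall X, smooth_section X -> forall x, bracket X X x = 0 ;
  bracket_linearl : forall (c : R) X Y Z,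
    smooth_section X -> smooth_section Y -> smooth_section Z ->
    forall x, bracket (fun y => c *: X y + Y y) Z x
      = c *: bracket X Z x + bracket Y Z x ;
  bracket_linearr : forall (c : R) X Y Z,
    smooth_section X -> smooth_section Y -> smooth_section Z ->
    forall x, bracket Z (fun y => c *: X y + Y y) x
      = c *: bracket Z X x + bracket Z Y x ;
  bracket_jacobi : forall X Y Z,
    smooth_section X -> smooth_section Y -> smooth_section Z ->
    forall x, bracket X (bracket Y Z) x + bracket Y (bracket Z X) x
      + bracket Z (bracket X Y) x = 0 ;
  bracket_leibniz : forall X Y (phi : S -> R),
    smooth_section X -> smooth_section Y -> smooth_on setT phi ->
    forall x, bracket X (fun y => phi y *: Y y) x
      = phi x *: bracket X Y x + tder x (anchor x (X x)) phi *: Y x }.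

(** * The Lie algebra of Killing fields of R^n and the group SO(n) |x R^n *)

Section Killing.
Variables (R : realType) (n : nat).

Definition vfield : lmodType R := ('rV[R]_n -> 'rV[R]_n : lmodType R).

Definition killing (X : vfield) : Prop :=
  Csmooth [set: 'rV[R]_n] (X : 'rV[R]_n -> 'rV[R]_n) /\
  forall m u v : 'rV[R]_n, dot ('D_u X m) v + dot u ('D_v X m) = 0.

Definition vf_bracket (X Y : vfield) : vfield :=
  fun m => 'D_(X m) Y m - 'D_(Y m) X m.

Definition const_field (b : 'rV[R]_n) : vfield := fun=> b.

(* Acting on row vectors from the right. *)
Record euclidean := Euclidean {
  eu_rot : 'M[R]_n ;
  eu_transl : 'rV[R]_n ;
  eu_rot_orth : eu_rot *m eu_rot^T = 1%:M ;
  eu_rot_det : \det eu_rot = 1 }.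

Definition eu_act (l : euclidean) (m : 'rV[R]_n) : 'rV[R]_n :=
  m *m eu_rot l + eu_transl l.

(* Push-forward of vector fields: (Ad l X)(eu_act l m) is the differential of
   [eu_act l] applied to X m. *)
Definition Ad (l : euclidean) (X : vfield) : vfield :=
  fun m => X ((m - eu_transl l) *m (eu_rot l)^T) *m eu_rot l.

End Killing.

Definition has_dim (R : realType) (V : lmodType R) (P : V -> Prop) (D : nat) :
    Prop :=
  exists b : 'I_D -> V, (forall i, P (b i)) /\
    forall v, P v -> exists! c : 'rV[R]_D, v = \sum_i c 0 i *: b i.

(** * Morphisms into the trivial bundle E of Killing fields *)

Section Morphisms.
Variables (R : realType) (n d : nat) (S : manifold R d).

(* The canonical flat connection on sections of E. *)
Definition nabla (x : S) (u : 'rV[R]_d) (Xi : S -> vfield R n) : vfield R n :=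
  fun m => tder x u (fun y => Xi y m).

Variables (r : nat) (A : lieAlgebroid S r).

(* Since the Killing fields form a finite dimensional space, on which the
   evaluations at the points m separate points, a map into it is smooth iff its
   composites with these evaluations are. *)
Definition smooth_morphism (w : forall x, A x -> vfield R n) : Prop :=
  forall X : (forall x, A x), smooth_section X ->
  forall m, smooth_on setT (fun x => w x (X x) m).

(* Lie algebroid morphisms from A to the Lie algebra of Killing fields,
   viewed as a Lie algebroid over a point. *)
Record g_morphism := GMorphism {
  mor :> forall x, {linear A x -> vfield R n} ;
  mor_killing : forall x a, killing (mor x a) ;
  mor_smooth : smooth_morphism mor ;
  mor_bracket : forall X Y, smooth_section X -> smooth_section Y ->
    forall x, mor x (bracket X Y x)
      = nabla x (anchor A x (X x)) (fun y => mor y (Y y))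
        - nabla x (anchor A x (Y x)) (fun y => mor y (X y))
        + vf_bracket (mor x (X x)) (mor x (Y x)) }.

Definition inf_immersion (w : g_morphism) : Prop :=
  [/\ forall x u, exists a, anchor A x a = u,
      forall x, injective (w x),
      exists x0 m0, forall a, anchor A x0 a = 0 -> w x0 a m0 = 0
    & exists2 D, has_dim (@killing R n) D & D%:Z - r%:Z = n%:Z - d%:Z].

(** * Logarithmic derivative and primitives *)

(* The fibre of A(f) at x, as a subspace of the Killing fields. *)
Definition logder_fib (f : S -> 'rV[R]_n) (x : S) (xi : vfield R n) : Prop :=
  killing xi /\ exists u, tder x u f = xi (f x).

(* For f an immersion and xi in the fibre of A(f), this is the unique u such
   that [tder x u f = xi (f x)]. *)
Definition logder_anchor (f : S -> 'rV[R]_n) (x : S) (xi : vfield R n) :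
    'rV[R]_d :=
  xget 0 [set u | tder x u f = xi (f x)].

Definition logder_bracket (f : S -> 'rV[R]_n) (X Y : S -> vfield R n) :
    S -> vfield R n :=
  fun x => nabla x (logder_anchor f x (X x)) Y
           - nabla x (logder_anchor f x (Y x)) X + vf_bracket (X x) (Y x).

(* Lie algebroid morphisms A -> A(f) over the identity.  As A(f) is a subset of
   E and its logarithmic derivative is the projection of E, lambda is at the
   same time its composite with the logarithmic derivative. *)
Definition logder_morphism (f : S -> 'rV[R]_n)
    (lambda : forall x, {linear A x -> vfield R n}) : Prop :=
  [/\ forall x a, logder_fib f x (lambda x a),
      smooth_morphism lambda,
      forall x a, logder_anchor f x (lambda x a) = anchor A x a
    & forall X Y, smooth_section X -> smooth_section Y ->
      forall x, lambda x (bracket X Y x)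
        = logder_bracket f (fun y => lambda y (X y)) (fun y => lambda y (Y y)) x].

Definition primitive (w : g_morphism) (f : S -> 'rV[R]_n) : Prop :=
  exists (lambda : forall x, {linear A x -> vfield R n}) (l : euclidean R n),
    logder_morphism f lambda /\ forall x a, lambda x a = Ad l (w x a).

(** * Fundamental forms *)

(* The family v followed by b; it has n terms when n = d + 1. *)
Definition extend (T : Type) (v : 'I_d -> T) (b : T) : 'I_n -> T :=
  fun i => if insub (val i) is Some k then v k else b.

Variable o : orientation S.

Section OfMorphism.
Variable w : g_morphism.

(* The fibre at x of ker #, as a subspace of the Killing fields. *)
Definition isotropy (x : S) (xi : vfield R n) : Prop :=
  exists2 a, anchor A x a = 0 & xi = w x a.

(* The constant field congruent to xi modulo [isotropy x]: the inverse of the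
   isomorphism from the constant fields onto the fibre of E/h. *)
Definition const_part (x : S) (xi : vfield R n) : 'rV[R]_n :=
  xget 0 [set b | isotropy x (xi - const_field b)].

(* A representative in E of u, seen as an element of E/h. *)
Definition tlift (x : S) (u : 'rV[R]_d) : vfield R n :=
  w x (xget 0 [set a | anchor A x a = u]).

Definition quot_inner (x : S) (xi eta : vfield R n) : R :=
  dot (const_part x xi) (const_part x eta).

Definition first_form_of (x : S) (u v : 'rV[R]_d) : R :=
  quot_inner x (tlift x u) (tlift x v).

(* The classes of the xi i form a positively oriented basis of the fibre of E/h
   at x. *)
Definition quot_pos_basis (x : S) (xi : 'I_n -> vfield R n) : Prop :=
  exists m, (forall eta, isotropy x eta <-> killing eta /\ eta m = 0) /\
    0 < \det (\matrix_(i < n) xi i m).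

Definition is_normal_of (x : S) (b : 'rV[R]_n) : Prop :=
  [/\ forall c, (exists a, w x a = const_field c) -> dot b c = 0,
      dot b b = 1
    & forall v, pos_basis o x v ->
        quot_pos_basis x (extend (fun k => tlift x (v k)) (const_field b))].

Definition normal_of (x : S) : 'rV[R]_n := xget 0 [set b | is_normal_of x b].

Definition anchor_of (x : S) (xi : vfield R n) : 'rV[R]_d :=
  anchor A x (xget 0 [set a | w x a = xi]).

Definition second_form_of (x : S) (u v : 'rV[R]_d) : R :=
  - first_form_of x
      (anchor_of x (nabla x u (fun y => const_field (normal_of y)))) v.

End OfMorphism.

Definition first_form (f : S -> 'rV[R]_n) (x : S) (u v : 'rV[R]_d) : R :=
  dot (tder x u f) (tder x v f).

Definition is_unit_normal (f : S -> 'rV[R]_n) (x : S) (b : 'rV[R]_n) : Prop :=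
  [/\ forall u, dot b (tder x u f) = 0,
      dot b b = 1
    & forall v, pos_basis o x v ->
        0 < \det (\matrix_(i < n) extend (fun k => tder x (v k) f) b i)].

Definition unit_normal (f : S -> 'rV[R]_n) (x : S) : 'rV[R]_n :=
  xget 0 [set b | is_unit_normal f x b].

(* The pulled back Levi-Civita connection of R^n differentiates the vector field
   Tf(V) along f componentwise. *)
Definition second_form (f : S -> 'rV[R]_n) (x : S) (u : 'rV[R]_d)
    (V : S -> 'rV[R]_d) : R :=
  dot (tder x u (fun y => tder y (V y) f)) (unit_normal f x).

End Morphisms.

(* Main.v *)
(* Up to the choice of l, a primitive of w is a map f with Tf(# a) = w(a)(f).
   Its value f(x) must be a common zero of the fields in w(ker #|x), and for
   dimension reasons these fields are then exactly g_f(x), which determines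
   f(x).  This gives uniqueness, and leaves no choice in the construction of f.
   The set U of the x for which a common zero exists is open: its existence
   amounts to the injectivity of the linear part on w(ker #|x), because
   H^1(so(n), R^n) = 0.  It is closed because on U the function 1 + |f|^2 grows
   at most exponentially along curves, the rotation part of w(a) being
   orthogonal to f.  Hence U = Sigma.  Differentiating w(Y)(f) = 0 for sections Y
   of ker #, and using that [X, Y] is again a section of ker #, yields
   Tf(# a) = w(a)(f).  Evaluation at f(x) identifies E/h with R^n,
   and thereby the forms and the normal of w with those of f. *)

From HB Require Import structures.
Require Import Defs.
From mathcomp Require Import all_boot all_order all_algebra.
From mathcomp Require Import all_classical all_reals all_analysis.
From mathcomp Require Import ring lra zify.

Set Implicit Arguments.
Unset Strict Implicit.
Unset Printing Implicit Defensive.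

Import Order.TTheory GRing.Theory Num.Theory.
Import numFieldNormedType.Exports.

Local Open Scope classical_set_scope.
Local Open Scope ring_scope.

(** * Smooth functions *)

(** The hypothesis on the rank says that [ker #] has rank dim so(n). On the isotropy at a point, the
    linear part is therefore injective if and only if it is onto so(n): injectivity makes the values
    at the origin a cocycle, while surjectivity is open and produces isotropy elements with
    prescribed rotation part. A point is bad when its isotropy contains a nonzero translation; near
    such a point the common zero would have to escape to infinity. This is why a bound on f gives
    closedness: for a section Y of ker # whose value at the limit is a translation, the equation
    w(Y)(f) = 0 has a linear part tending to 0 and a translation part that does not. Two obstacles
    shape the technical part. The bracket acts on global sections, so elements of A and of ker #
    must first be extended globally, by bump functions and polynomial formulas in a local frame. And
    tangent coordinates and orientation signs refer to preferred charts that may jump from point to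
    point, so smoothness is always transferred to one fixed chart. *)

Section DifferentiableNear.
Variables (R : realType) (E W : normedModType R).

Lemma near_eq_differentiable (f g : E -> W) (x : E) :
  (\near x, f x = g x) -> differentiable f x -> differentiable g x.
Proof.
move=> fg df; have fgx := nbhs_singleton fg.
have [dfc dfe] := (diff_locallyP x f).1 df.
have ge : g \o shift x = cst (g x) + 'd f x +o_ 0 id.
  apply/eqaddoP => e e0; move/eqaddoP : dfe => /(_ e e0) H.
  have fg0 : \forall h \near (0 : E), f (h + x) = g (h + x).
    by move: fg; rewrite (near_shift 0 x); apply: filterS => h /=; rewrite subr0.
  near=> h.
  have -> : (g \o shift x - (cst (g x) + 'd f x)) h
      = (f \o shift x - (cst (f x) + 'd f x)) h.
    rewrite !fctE /=; have -> : g (h + x) = f (h + x) by rewrite (near fg0 h).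
    by rewrite fgx.
  by near: h.
apply/diff_locallyP; rewrite (diff_unique dfc ge); split=> //.
Unshelve. all: by end_near. Qed.

End DifferentiableNear.

Section Ck.
Variables (R : realType) (E : normedModType R).

Lemma differentiable_rV n (f : E -> 'rV[R]_n) x :
  (forall j, differentiable (fun y => f y 0 j) x) -> differentiable f x.
Proof.
move=> h; have -> : f = \sum_(j < n) (fun y => f y 0 j *: delta_mx 0 j).
  by apply/funext => y; rewrite fct_sumE [LHS]row_sum_delta.
by apply: differentiable_sum => j; apply: differentiableZl.
Qed.

Lemma differentiable_rV_coord n (f : E -> 'rV[R]_n) x j :
  differentiable f x -> differentiable (fun y => f y 0 j) x.
Proof.
move=> h; apply: (@differentiable_comp _ _ _ _ f (fun v : 'rV[R]_n => v 0 j)) => //.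
exact: differentiable_coord.
Qed.

(** The set enters [Ck] only as the set of points where differentiability or continuity is required,
    so the condition is pointwise, whether or not the set is open. Restriction and gluing follow
    without topology. *)
Lemma Ck_pt (W : normedModType R) k (U : set E) (f : E -> W) :
  Ck k U f <-> forall x, U x -> Ck k [set x] f.
Proof.
elim: k f => [|k IH] f /=.
  by split=> h x Ux; [move=> _ ->; exact: h | exact: h Ux _ erefl].
split=> [[df h] x Ux|h]; split.
- by move=> _ ->; exact: df.
- by move=> v; exact: (IH _).1 (h v) x Ux.
- by move=> x Ux; apply: (h x Ux).1.
- by move=> v; apply/IH => x Ux; apply: (h x Ux).2.
Qed.

Lemma Ck_sub (W : normedModType R) k (U V : set E) (f : E -> W) :
  U `<=` V -> Ck k V f -> Ck k U f.
Proof. by move=> UV /Ck_pt h; apply/Ck_pt => x /UV; exact: h. Qed.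

Lemma Ck_cover (W : normedModType R) k (U : set E) (f : E -> W) :
  (forall x, U x -> exists V, V x /\ Ck k V f) -> Ck k U f.
Proof.
move=> h; apply/Ck_pt => x /h[V [Vx hV]]; apply: Ck_sub hV => _ -> //.
Qed.

Lemma Ck_ext (W : normedModType R) k (U : set E) (f g : E -> W) :
  open U -> (forall x, U x -> f x = g x) -> Ck k U f -> Ck k U g.
Proof.
move=> oU; have nU x : U x -> (forall x, U x -> f x = g x) -> \near x, f x = g x.
  by move=> Ux fg; near=> y; apply: fg; near: y; exact: open_nbhs_nbhs.
elim: k f g nU => [|k IH] f g nU fg /=.
  move=> h x Ux; suff : g @ x --> f x by rewrite (fg x Ux).
  by apply: cvg_trans (h x Ux); apply: near_eq_cvg; exact: nU.
move=> [df h]; split=> [x Ux|v].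
  exact: near_eq_differentiable (nU x Ux fg) (df x Ux).
apply: IH (h v) => x Ux; last exact: near_eq_derive (nU x Ux fg).
by move=> fg'; near=> y; apply: fg'; near: y; exact: open_nbhs_nbhs.
Unshelve. all: by end_near. Qed.

Lemma CkS (W : normedModType R) k (U : set E) (f : E -> W) :
  Ck k.+1 U f -> Ck k U f.
Proof.
elim: k f => [|k IH] f [df h].
  by move=> x /df; exact: differentiable_continuous.
by split=> // v; apply: IH; exact: h.
Qed.

Lemma Ck_cst (W : normedModType R) k (U : set E) (c : W) : Ck k U (cst c).
Proof.
elim: k c => [|k IH] c /=; first by move=> x _; exact: cvg_cst.
split=> // v; have -> : 'D_v (cst c) = cst (0 : W); last exact: IH.
by apply/funext => x; rewrite derive_cst.
Qed.

Lemma Ck_add (W : normedModType R) k (U : set E) (f g : E -> W) :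
  open U -> Ck k U f -> Ck k U g -> Ck k U (fun x => f x + g x).
Proof.
move=> oU; elim: k f g => [|k IH] f g /=.
  by move=> cf cg x Ux; apply: cvgD; [exact: cf|exact: cg].
move=> [df hf] [dg hg]; split=> [x Ux|v].
  by apply: (@differentiableD _ _ _ f g); [exact: df|exact: dg].
apply: (Ck_ext (f := fun x => 'D_v f x + 'D_v g x)) => //; last exact: IH.
by move=> x Ux; rewrite -deriveD //; apply: diff_derivable; [exact: df|exact: dg].
Qed.

Lemma Ck_mul k (U : set E) (f g : E -> R) :
  open U -> Ck k U f -> Ck k U g -> Ck k U (fun x => f x * g x).
Proof.
move=> oU; elim: k f g => [|k IH] f g.
  by move=> cf cg x Ux; apply: cvgM; [exact: cf|exact: cg].
move=> Cf Cg; move: (CkS Cf) (CkS Cg) => Cf' Cg'; case: Cf Cg => [df hf] [dg hg].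
split=> [x Ux|v].
  by apply: (@differentiableM _ _ f g); [exact: df|exact: dg].
apply: (Ck_ext (f := fun x => f x * 'D_v g x + g x * 'D_v f x)) => //.
  move=> x Ux; have /= := @deriveM _ _ f g x v.
  by move=> -> //; apply: diff_derivable; [exact: df|exact: dg].
by apply: Ck_add => //; [exact: IH Cf' (hg v) | exact: IH Cg' (hf v)].
Qed.

Lemma Ck_inv k (U : set E) (f : E -> R) :
  open U -> (forall x, U x -> f x != 0) -> Ck k U f -> Ck k U (fun x => (f x)^-1).
Proof.
move=> oU f0; elim: k f f0 => [|k IH] f f0.
  by move=> cf x Ux; apply: cvgV; [exact: f0|exact: cf].
move=> Cf; have Cf' := CkS Cf; case: Cf => [df hf].
split=> [x Ux|v].
  by apply: (@differentiableV _ _ f); [exact: df|exact: f0].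
apply: (Ck_ext (f := fun x => -1 * ((f x)^-1 * (f x)^-1 * 'D_v f x))) => //.
  move=> x Ux; have /= := @deriveV _ _ f x v (f0 x Ux).
  move=> ->; last by apply: diff_derivable; exact: df.
  by rewrite -exprVn expr2 scaleNr mulN1r.
apply: Ck_mul => //; first exact: Ck_cst.
have CV := IH f f0 Cf'.
by apply: Ck_mul => //; [apply: Ck_mul | exact: hf].
Qed.

Lemma cvg_rV n (T : Type) (F : set_system T) {FF : Filter F} (f : T -> 'rV[R]_n) (l :
  'rV[R]_n) :
  (forall j, f x 0 j @[x --> F] --> l 0 j) -> f @ F --> l.
Proof.
move=> h; apply/cvgrPdist_le => /= e e0; near=> x.
rewrite [leLHS]/Num.Def.normr/= mx_normrE (bigmax_le _ (ltW e0))//= => -[i j] _.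
rewrite !mxE ord1 /=; move: j; near: x; apply: filter_forall => j.
exact: ((cvgrPdist_le _ _).1 (h j)).
Unshelve. all: by end_near. Qed.

Lemma cvg_rV_coord n (T : Type) (F : set_system T) {FF : Filter F} (f :
  T -> 'rV[R]_n) (l : 'rV[R]_n) j :
  f @ F --> l -> f x 0 j @[x --> F] --> l 0 j.
Proof.
move=> fl; apply: (@cvg_comp _ _ _ f (fun v : 'rV[R]_n => v 0 j) _ _ _ fl).
exact: coord_continuous.
Qed.

Lemma Ck_rV n k (U : set E) (f : E -> 'rV[R]_n) :
  open U -> Ck k U f <-> forall j, Ck k U (fun x => f x 0 j).
Proof.
move=> oU; elim: k f => [|k IH] f.
  split=> h; first by move=> j x Ux; apply: cvg_rV_coord; exact: h.
  by move=> x Ux; apply: cvg_rV => j; exact: h.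
split=> [[df hf] j|h].
  split=> [x Ux|v]; first by apply: differentiable_rV_coord; exact: df.
  have /IH/(_ j) := hf v; apply: Ck_ext => // x Ux.
  by rewrite derive_mx ?mxE//; apply: diff_derivable; exact: df.
have df x : U x -> differentiable f x.
  by move=> Ux; apply: differentiable_rV => j; have [+ _] := h j; exact.
split=> // v; apply/IH => j.
have [_ /(_ v)] := h j; apply: Ck_ext => // x Ux.
by rewrite derive_mx ?mxE//; apply: diff_derivable; exact: df.
Qed.

End Ck.

(** * Flat functions, the source of smooth cutoffs *)

Section Flat.
Variable R : realType.

(* All derivatives of [exp(-1/s)] are combinations of these functions. *)
Definition flat (j : nat) (s : R) : R :=
  if 0 < s then s ^- j * expR (- s^-1) else 0.

Lemma flat_ge0 j s : 0 <= flat j s.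
Proof.
rewrite /flat; case: ifPn => // s0.
by rewrite mulr_ge0 ?expR_ge0 // invr_ge0 exprn_ge0 // ltW.
Qed.

Lemma flat_le j (s : R) : 0 < s -> flat j.+1 s <= (j.+2%:R) ^+ j.+2 * s.
Proof.
move=> s0; rewrite /flat s0 expRN.
(* One power more than [j.+1]: the inequality [expR (1/s) >= (1/(m s))^m] then leaves a factor [s]
   over. *)
set m := j.+2; have m0 : (0 : R) < m%:R by rewrite ltr0n.
have e1 : (m%:R * s)^-1 ^+ m <= expR s^-1.
  have -> : s^-1 = (m%:R * s)^-1 * m%:R.
    by rewrite invfM mulrAC mulVf ?mul1r // gt_eqF.
  rewrite [X in expR X]mulrC expRM_natl lerXn2r ?nnegrE ?expR_ge0 //.
    by rewrite invr_ge0 mulr_ge0 ?ltW.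
  by apply: le_trans (expR_ge1Dx _); rewrite lerDr.
have p0 : 0 < (m%:R * s)^-1 ^+ m by rewrite exprn_gt0 // invr_gt0 mulr_gt0.
have : (expR s^-1)^-1 <= ((m%:R * s)^-1 ^+ m)^-1 by rewrite lef_pV2 ?posrE ?expR_gt0.
rewrite -exprVn invrK exprMn => h.
rewrite ler_pdivrMl ?exprn_gt0 //; apply: le_trans h _.
by rewrite [leRHS]mulrCA -[s ^+ j.+1 * s]exprSr.
Qed.

Lemma flat_norm_le j (s : R) : `|s^-1 * flat j s| <= (j.+2%:R) ^+ j.+2 * `|s|.
Proof.
have [s0|s0] := ltP 0 s; last first.
  by rewrite /flat ltNge s0 /= mulr0 normr0 mulr_ge0 // exprn_ge0.
have -> : s^-1 * flat j s = flat j.+1 s.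
  by rewrite /flat s0 mulrA exprS invfM.
by rewrite ger0_norm ?flat_ge0 // gtr0_norm //; exact: flat_le.
Qed.

(** The formula is the usual derivative for [s > 0], and both sides vanish for [s < 0]. At 0 the
    difference quotient [flat j s / s] tends to 0 by [flat_norm_le]. *)
Lemma is_derive_flat j (s : R) :
  is_derive s 1 (flat j) (- j%:R * flat j.+1 s + flat j.+2 s).
Proof.
have [s0|s0|s0] := ltgtP 0 s.
- pose g (t : R) := t ^- j * expR (- t^-1).
  apply: (@near_eq_is_derive _ _ _ g).
    near=> t; rewrite /flat /g; have -> // : 0 < t.
    by near: t; exact: lt_nbhsr.
  have sn0 : s != 0 by rewrite gt_eqF.
  have d1 : is_derive s 1 (fun t : R => (t ^+ j)^-1) (- (s ^+ j) ^- 2 * (j%:R * s ^+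
    j.-1)).
    have h := @exprn_derivable R j s 1.
    split; first by apply: (@derivableV _ _ (fun t : R => t ^+ j)) => //;
      rewrite expf_neq0.
    rewrite (@deriveV _ _ (fun t : R => t ^+ j)) ?expf_neq0 // exp_derive.
    by rewrite /GRing.scale /= mulr1.
  have d2 : is_derive s 1 (fun t : R => t^-1) (- s ^- 2).
    split; first exact: (@derivableV _ _ id).
    by rewrite (@deriveV _ _ id) // derive_id /GRing.scale /= mulr1.
  have d3 : is_derive s 1 (fun t : R => expR (- t^-1)) (s ^- 2 * expR (- s^-1)).
    have d4 : is_derive s 1 (fun t : R => - t^-1) (s ^- 2).
      by apply: is_derive_eq; rewrite opprK.
    have := @is_derive1_comp _ expR (fun t : R => - t^-1) s _ _ _ d4.
    by move=> /(_ _ (is_derive_expR _)); rewrite mulrC.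
  apply: is_derive_eq; rewrite /flat s0 /GRing.scale /=.
  have -> : s ^- j.+1 = s^-1 * s ^- j by rewrite exprS invfM.
  have -> : s ^- j.+2 = s ^- 2 * s ^- j by rewrite -addn2 addnC exprD invfM.
  case: (j) => [|j']; first by rewrite !mul0r expr0 invr1; ring.
  have s' : s ^+ j' != 0 by rewrite expf_neq0.
  by rewrite /= exprS; field; rewrite sn0 s'.
- apply: (@near_eq_is_derive _ _ _ (cst 0)).
    near=> t; rewrite /flat; have -> // : (0 < t) = false.
    apply/negbTE; rewrite -leNgt; apply: ltW.
    by near: t; exact: lt_nbhsl.
  by rewrite /flat !ltNge !(ltW s0) /= mulr0 addr0; exact: is_derive_cst.
- rewrite -s0 /flat ltxx mulr0 addr0.
  have h : h^-1 *: ((flat j \o shift 0) (h *: 1) - flat j 0) @[h --> 0^'] --> (0 : R).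
    apply/cvgr0Pnorm_le => e e0; near=> t.
    rewrite /= /shift /= addr0 /flat ltxx subr0 -/(flat j _) /GRing.scale /= mulr1.
    apply: le_trans (flat_norm_le j t) _.
    have m0 : (0 : R) < (j.+2%:R) ^+ j.+2 by rewrite exprn_gt0 // ltr0n.
    rewrite -ler_pdivlMl // mulrC; near: t; apply: dnbhs0_le.
    by rewrite divr_gt0.
  by split; [apply/cvg_ex; exists 0 | apply: cvg_lim].
Unshelve. all: by end_near. Qed.

(** The induction on [k] carries all [j] at once, since differentiating [flat j] brings in
    [flat j.+1] and [flat j.+2]. *)
Lemma Ck_flat (E : normedModType R) k (U : set E) (g : E -> R) j :
  open U -> Ck k U g -> Ck k U (fun x => flat j (g x)).
Proof.
move=> oU; elim: k g j => [|k IH] g j.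
  move=> cg x Ux; apply: (@continuous_comp _ _ _ g (flat j)); first exact: cg.
  apply: differentiable_continuous; apply/derivable1_diffP.
  exact: (ex_derive (is_derive := is_derive_flat j (g x))).
move=> Cg; have Cg' := CkS Cg; case: Cg => [dg hg].
have dh s : differentiable (flat j) s.
  by apply/derivable1_diffP; exact: (ex_derive (is_derive := is_derive_flat j s)).
split=> [x Ux|v].
  by apply: (@differentiable_comp _ _ _ _ g (flat j)); [exact: dg | exact: dh].
apply: (Ck_ext (f := fun x => (- j%:R * flat j.+1 (g x) + flat j.+2 (g x)) * 'D_v g
  x)) => //.
  move=> x Ux; have dc : differentiable (flat j \o g) x.
    by apply: differentiable_comp; [exact: dg | exact: dh].
  rewrite [RHS](deriveE v dc) diff_comp; [|exact: dg|exact: dh].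
  rewrite /= -(deriveE v (dg _ Ux)) -[X in 'd (flat j) _ X]mulr1.
  rewrite -[_ * 1]/(_ *: _) linearZ /= -deriveE //.
  by rewrite (derive_val (is_derive := is_derive_flat j (g x))) mulrC.
apply: Ck_mul => //; last exact: hg.
apply: Ck_add => //; last exact: IH.
by apply: Ck_mul => //; [exact: Ck_cst | exact: IH].
Qed.

End Flat.

Section CkBig.
Variables (R : realType) (E : normedModType R).

Lemma Ck_sum (W : normedModType R) k (U : set E) (I : Type) (r : seq I) (P :
  pred I) (F : I -> E -> W) :
  open U -> (forall i, P i -> Ck k U (F i)) ->
  Ck k U (fun x => \sum_(i <- r | P i) F i x).
Proof.
move=> oU h; have -> : (fun x => \sum_(i <- r | P i) F i x) = \sum_(i <- r | P i) F i.
  by apply/funext => x; rewrite fct_sumE.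
elim/big_rec: _ => [|i f Pi Cf]; first exact: (Ck_cst k U (0 : W)).
exact: Ck_add oU (h i Pi) Cf.
Qed.

Lemma Ck_prod k (U : set E) (I : Type) (r : seq I) (P : pred I) (F : I -> E -> R) :
  open U -> (forall i, P i -> Ck k U (F i)) ->
  Ck k U (fun x => \prod_(i <- r | P i) F i x).
Proof.
move=> oU h; elim: r => [|i r IH].
  by apply: (Ck_ext (f := cst (1 : R))) => // [x _|]; [rewrite big_nil | exact: Ck_cst].
case Pi : (P i).
  apply: (Ck_ext (f := fun x => F i x * \prod_(j <- r | P j) F j x)) => //.
    by move=> x _; rewrite big_cons Pi.
  exact: Ck_mul oU (h i Pi) IH.
by apply: Ck_ext IH => // x _; rewrite big_cons Pi.
Qed.

Lemma Ck_det k (U : set E) n (M : E -> 'M[R]_n) :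
  open U -> (forall i j, Ck k U (fun x => M x i j)) -> Ck k U (fun x => \det (M x)).
Proof.
move=> oU h; rewrite /determinant; apply: Ck_sum => // s _.
apply: Ck_mul => //; first exact: Ck_cst.
by apply: Ck_prod => // i _; exact: h.
Qed.

Lemma Ck_cofactor k (U : set E) n (M : E -> 'M[R]_n) i j :
  open U -> (forall i j, Ck k U (fun x => M x i j)) ->
    Ck k U (fun x => cofactor (M x) i j).
Proof.
move=> oU h; rewrite /cofactor; apply: Ck_mul => //; first exact: Ck_cst.
apply: Ck_det => // a b.
suff -> : (fun x => row' i (col' j (M x)) a b) = (fun x =>
  M x (lift i a) (lift j b)) by exact: h.
by apply/funext => x; rewrite !mxE.
Qed.

End CkBig.

(** * Smooth functions on a manifold, read in charts *)

Section SmoothOn.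
Variables (R : realType) (d : nat) (S : manifold R d).
Implicit Types (U V : set S) (x y : S).

Lemma near_cinv i x (P : set S) :
  cdom i x -> (\near x, P x) -> \forall q \near chart i x, P (cinv i q).
Proof.
move=> ix Px; have /= := cinv_continuous (m := S) (i := i) (y := chart i x).
by move=> /(_ (ex_intro2 _ _ x ix erefl)) /(_ P); rewrite chartK //; apply.
Qed.

Lemma near_chart i x (P : set 'rV[R]_d) :
  cdom i x -> (\forall q \near chart i x, P q) -> \near x, P (chart i x).
Proof. by move=> ix; apply: chart_continuous. Qed.

Lemma near_cdom i x : cdom i x -> \near x, cdom i x.
Proof. by move=> ix; apply: open_nbhs_nbhs; split => //; exact: cdom_open. Qed.

Lemma near_cimg i x : cdom i x ->
  \forall q \near chart i x, cdom i (cinv i q) /\ chart i (cinv i q) = q.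
Proof.
move=> ix; near=> q.
have [y iy <-] : (chart i @` cdom i) q.
  near: q; apply: open_nbhs_nbhs; split; first exact: cimg_open.
  by exists x.
by rewrite chartK.
Unshelve. all: by end_near. Qed.

Lemma open_chart_image i U : open U -> open (chart i @` (cdom i `&` U)).
Proof.
move=> oU; rewrite openE => _ [x [ix Ux] <-].
have Ux' : \near x, U x by apply: open_nbhs_nbhs.
rewrite /interior; near=> q.
have [iq qE] : cdom i (cinv i q) /\ chart i (cinv i q) = q by near: q; exact: near_cimg.
exists (cinv i q) => //; split => //.
by near: q; exact: near_cinv.
Unshelve. all: by end_near. Qed.

Lemma smooth_on_ext (W : normedModType R) U (F G : S -> W) :
  open U -> (forall x, U x -> F x = G x) -> smooth_on U F -> smooth_on U G.
Proof.
move=> oU FG h i k; apply: Ck_ext (h i k); first exact: open_chart_image.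
by move=> _ [x [ix Ux] <-] /=; rewrite chartK // FG.
Qed.

Lemma smooth_on_sub (W : normedModType R) U V (F : S -> W) :
  U `<=` V -> smooth_on V F -> smooth_on U F.
Proof.
move=> UV h i k; apply: Ck_sub (h i k) => _ [x [ix Ux] <-].
by exists x => //; split => //; exact: UV.
Qed.

Lemma smooth_on_cover (W : normedModType R) U (F : S -> W) :
  (forall x, U x -> exists V, V x /\ smooth_on V F) -> smooth_on U F.
Proof.
move=> h i k; apply: Ck_cover => _ [x [ix Ux] <-].
have [V [Vx hV]] := h x Ux; exists (chart i @` (cdom i `&` V)).
by split; [exists x | exact: hV].
Qed.

Lemma smooth_on_cst (W : normedModType R) U (c : W) : smooth_on U (fun=> c).
Proof. by move=> i k; exact: Ck_cst. Qed.

Lemma smooth_on_add (W : normedModType R) U (F G : S -> W) : open U ->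
  smooth_on U F -> smooth_on U G -> smooth_on U (fun x => F x + G x).
Proof.
move=> oU hF hG i k; have oI := open_chart_image (i := i) oU.
exact: (@Ck_add _ _ _ k _ (F \o cinv (m:=S) i) (G \o cinv (m:=S) i) oI (hF i k) (hG i k)).
Qed.

Lemma smooth_on_mul U (F G : S -> R) : open U ->
  smooth_on U F -> smooth_on U G -> smooth_on U (fun x => F x * G x).
Proof.
move=> oU hF hG i k; have oI := open_chart_image (i := i) oU.
exact: (@Ck_mul _ _ k _ (F \o cinv (m:=S) i) (G \o cinv (m:=S) i) oI (hF i k) (hG i k)).
Qed.

Lemma smooth_on_opp U (F : S -> R) : open U ->
  smooth_on U F -> smooth_on U (fun x => - F x).
Proof.
move=> oU h; under eq_fun do rewrite -mulN1r.
by apply: smooth_on_mul => //; exact: smooth_on_cst.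
Qed.

Lemma smooth_on_sum (W : normedModType R) U (I : Type) (r : seq I) (P : pred I) (F :
  I -> S -> W) :
  open U -> (forall i, P i -> smooth_on U (F i)) ->
  smooth_on U (fun x => \sum_(i <- r | P i) F i x).
Proof.
move=> oU h i k.
apply: (@Ck_sum _ _ _ k _ _ _ _ (fun a => F a \o cinv (m:=S) i)).
  exact: open_chart_image.
by move=> a Pa; exact: h.
Qed.

Lemma smooth_on_det U n (M : S -> 'M[R]_n) : open U ->
  (forall i j, smooth_on U (fun x => M x i j)) -> smooth_on U (fun x => \det (M x)).
Proof.
move=> oU h i k; apply: (@Ck_det _ _ _ _ _ (M \o cinv (m:=S) i)).
  exact: open_chart_image.
by move=> a b; exact: h.
Qed.

Lemma smooth_on_cofactor U n (M : S -> 'M[R]_n) a b : open U ->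
  (forall i j, smooth_on U (fun x => M x i j)) ->
  smooth_on U (fun x => cofactor (M x) a b).
Proof.
move=> oU h i k; apply: (@Ck_cofactor _ _ _ _ _ (M \o cinv (m:=S) i)).
  exact: open_chart_image.
by move=> a' b'; exact: h.
Qed.

Lemma smooth_on_inv U (F : S -> R) : open U -> (forall x, U x -> F x != 0) ->
  smooth_on U F -> smooth_on U (fun x => (F x)^-1).
Proof.
move=> oU F0 h i k; apply: (@Ck_inv _ _ k _ (F \o cinv (m:=S) i) _ _ (h i k));
  first exact: open_chart_image.
by move=> _ [x [ix Ux] <-] /=; rewrite chartK // F0.
Qed.

Lemma smooth_on_flat U (F : S -> R) j : open U ->
  smooth_on U F -> smooth_on U (fun x => flat j (F x)).
Proof. move=> oU h i k; have oI := open_chart_image (i := i) oU.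
exact: (@Ck_flat _ _ k _ (F \o cinv (m:=S) i) j oI (h i k)). Qed.

Lemma smooth_on_rV U n (F : S -> 'rV[R]_n) : open U ->
  smooth_on U F <-> forall j, smooth_on U (fun x => F x 0 j).
Proof.
move=> oU; split=> [h j i k|h i k].
  by have /Ck_rV := h i k; apply; exact: open_chart_image.
by apply/Ck_rV => [|j]; [exact: open_chart_image | exact: h].
Qed.

Lemma smooth_on_chart i : smooth_on (cdom i) (chart (m := S) i).
Proof. by move=> j k; exact: chart_smooth. Qed.

Lemma smooth_on_differentiable (W : normedModType R) U (F : S -> W) i x :
  smooth_on U F -> U x -> cdom i x -> differentiable (F \o cinv (m:=S) i) (chart i x).
Proof. by move=> h Ux ix; have [+ _] := h i 1; apply; exists x. Qed.

Lemma smooth_on_continuous (W : normedModType R) U (F : S -> W) x :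
  smooth_on U F -> U x -> {for x, continuous F}.
Proof.
move=> h Ux; have ix := cdom_at (m := S) x; set i := chart_at x in ix.
have /= := h i 0 (chart i x) (ex_intro2 _ _ x (conj ix Ux) erefl).
move=> cF; have : (F \o cinv i \o chart i) @ x --> F x.
  have cF' : F \o cinv (m := S) i @ chart i x --> F x by rewrite -[X in F X](chartK
    ix); exact: cF.
  exact: cvg_comp (chart_continuous ix) cF'.
apply: cvg_trans; apply: near_eq_cvg; near=> y.
by rewrite /= chartK //; near: y; exact: near_cdom.
Unshelve. all: by end_near. Qed.

End SmoothOn.

Lemma derive_comp (R : realType) (E V W : normedModType R) (g : E -> V) (f : V -> W) p u :
  differentiable g p -> differentiable f (g p) ->
  'D_u (f \o g) p = 'D_('D_u g p) f (g p).
Proof.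
move=> dg df; rewrite (deriveE _ dg) (deriveE _ df).
by rewrite (deriveE _ (differentiable_comp dg df)) diff_comp.
Qed.

(** * Derivatives along tangent vectors *)

Section TangentDerivative.
Variables (R : realType) (d : nat) (S : manifold R d).
Implicit Types (U V : set S) (x y : S).

Definition tdiff (W : normedModType R) x (F : S -> W) : Prop :=
  differentiable (F \o cinv (m:=S) (chart_at x)) (chart (chart_at x) x).

Lemma smooth_on_tdiff (W : normedModType R) U x (F : S -> W) :
  smooth_on U F -> U x -> tdiff x F.
Proof. by move=> h Ux; apply: smooth_on_differentiable h Ux _; exact: cdom_at. Qed.

(** Chain rule for the transition map from the preferred chart at [x] to chart [i]: the components
    of [u] in chart [i] are [tder x u (chart i)]. *)
Lemma tder_chart (W : normedModType R) i x u (F : S -> W) : cdom i x ->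
  differentiable (F \o cinv (m:=S) i) (chart i x) ->
  tder x u F = 'D_(tder x u (chart (m:=S) i)) (F \o cinv (m:=S) i) (chart i x).
Proof.
move=> ix dF; rewrite /tder; set c := chart_at x; set p := chart c x.
have cx : cdom c x := cdom_at x.
set g := chart i \o cinv (m:=S) c.
have gp : g p = chart i x by rewrite /g /p /= chartK.
have dg : differentiable g p.
  by apply: smooth_on_differentiable (@smooth_on_chart _ _ S i) ix cx.
have -> : 'D_u (F \o cinv (m:=S) c) p = 'D_u ((F \o cinv (m:=S) i) \o g) p.
  apply: near_eq_derive; near=> q; rewrite /g /= chartK //.
  by near: q; apply: near_cinv => //; exact: near_cdom.
rewrite -gp in dF *; exact: derive_comp.
Unshelve. all: by end_near. Qed.

Lemma tder_chart_self x u : tder x u (chart (m:=S) (chart_at x)) = u.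
Proof.
rewrite /tder -[RHS](@derive_id _ _ (chart (chart_at x) x)).
apply: near_eq_derive; near=> q; rewrite /=.
suff [] : cdom (chart_at x) (cinv (chart_at x) q) /\ chart (chart_at x) (cinv
  (chart_at x) q) = q by [].
by near: q; apply: near_cimg; exact: cdom_at.
Unshelve. all: by end_near. Qed.

Lemma tder_linear (W : normedModType R) x (F : S -> W) c u v :
  tdiff x F -> tder x (c *: u + v) F = c *: tder x u F + tder x v F.
Proof. by move=> dF; rewrite /tder !deriveE // linearP. Qed.

Lemma tder_sum (W : normedModType R) x (F : S -> W) (I : Type) (r : seq I) (P :
  pred I) (u : I -> 'rV[R]_d) :
  tdiff x F -> tder x (\sum_(i <- r | P i) u i) F = \sum_(i <- r | P i) tder x (u i) F.
Proof.
move=> dF; rewrite /tder deriveE // linear_sum; apply: eq_bigr => i _.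
by rewrite deriveE.
Qed.

Lemma tder0 (W : normedModType R) x (F : S -> W) : tder x 0 F = 0.
Proof. by rewrite /tder derive0. Qed.

Lemma tderZ (W : normedModType R) x (F : S -> W) c u :
  tdiff x F -> tder x (c *: u) F = c *: tder x u F.
Proof. by move=> dF; rewrite /tder !deriveE // linearZ. Qed.

Lemma tder_near (W : normedModType R) x u (F G : S -> W) :
  (\near x, F x = G x) -> tder x u F = tder x u G.
Proof.
move=> FG; apply: near_eq_derive.
by apply: (near_cinv (P := fun y => F y = G y)) => //; exact: cdom_at.
Qed.

Lemma tdiff_near (W : normedModType R) x (F G : S -> W) :
  (\near x, F x = G x) -> tdiff x F -> tdiff x G.
Proof.
move=> FG; apply: near_eq_differentiable.
by apply: (near_cinv (P := fun y => F y = G y)) => //; exact: cdom_at.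
Qed.

Lemma tder_cst (W : normedModType R) x u (a : W) : tder x u (fun=> a) = 0.
Proof. exact: derive_cst. Qed.

Lemma tder_add (W : normedModType R) x u (F G : S -> W) : tdiff x F -> tdiff x G ->
  tder x u (fun y => F y + G y) = tder x u F + tder x u G.
Proof.
by move=> dF dG; rewrite /tder -deriveD //; exact: diff_derivable.
Qed.

Lemma tder_mul x u (F G : S -> R) : tdiff x F -> tdiff x G ->
  tder x u (fun y => F y * G y) = F x * tder x u G + G x * tder x u F.
Proof.
move=> dF dG; rewrite /tder.
have := @deriveM _ _ (F \o cinv (m:=S) (chart_at x)) (G \o cinv (m:=S) (chart_at x))
  (chart (chart_at x) x) u (diff_derivable dF) (diff_derivable dG).
by rewrite /= !chartK //; exact: cdom_at.
Qed.

Lemma tder_rV n x u (F : S -> 'rV[R]_n) j : tdiff x F ->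
  tder x u F 0 j = tder x u (fun y => F y 0 j).
Proof.
by move=> dF; rewrite /tder derive_mx ?mxE //; exact: diff_derivable.
Qed.

Lemma tdiff_rV n x (F : S -> 'rV[R]_n) j : tdiff x F -> tdiff x (fun y => F y 0 j).
Proof. exact: differentiable_rV_coord. Qed.

Lemma tdiff_cst (W : normedModType R) x (a : W) : tdiff x (fun=> a).
Proof. exact: differentiable_cst. Qed.

Lemma tdiff_add (W : normedModType R) x (F G : S -> W) :
  tdiff x F -> tdiff x G -> tdiff x (fun y => F y + G y).
Proof. exact: differentiableD. Qed.

Lemma tdiff_mul x (F G : S -> R) :
  tdiff x F -> tdiff x G -> tdiff x (fun y => F y * G y).
Proof. exact: differentiableM. Qed.

Lemma tdiff_sum (W : normedModType R) x (I : Type) (r : seq I) (F : I -> S -> W) :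
  (forall i, tdiff x (F i)) -> tdiff x (fun y => \sum_(i <- r) F i y).
Proof.
move=> h; elim: r => [|i r IH].
  by apply: (tdiff_near (F := fun=> 0)); [near=> y; rewrite big_nil | exact: tdiff_cst].
apply: (tdiff_near (F := fun y => F i y + \sum_(j <- r) F j y)).
  by near=> y; rewrite big_cons.
exact: tdiff_add.
Unshelve. all: by end_near. Qed.

Lemma tder_sumr (W : normedModType R) x u (I : Type) (r : seq I) (F : I -> S -> W) :
  (forall i, tdiff x (F i)) ->
  tder x u (fun y => \sum_(i <- r) F i y) = \sum_(i <- r) tder x u (F i).
Proof.
move=> h; elim: r => [|i r IH].
  by rewrite big_nil -[RHS](tder_cst x u 0); apply: tder_near; near=> y; rewrite big_nil.
rewrite big_cons -IH -tder_add //; last exact: tdiff_sum.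
by apply: tder_near; near=> y; rewrite big_cons.
Unshelve. all: by end_near. Qed.

Lemma tder_dot n x u (F G : S -> 'rV[R]_n) : tdiff x F -> tdiff x G ->
  tder x u (fun y => dot (F y) (G y)) = dot (F x) (tder x u G) + dot (G x) (tder x u F).
Proof.
move=> dF dG; rewrite /dot tder_sumr => [|i]; last first.
  by apply: tdiff_mul; exact: tdiff_rV.
rewrite -big_split /=; apply: eq_bigr => i _.
by rewrite tder_mul; [rewrite !tder_rV | exact: tdiff_rV..].
Qed.

(** At each point [tder] reads its own preferred chart, which need not vary continuously. In the
    fixed chart [i] the function becomes the sum of the components of [Ve] times partial derivatives
    of [F], and both are smooth. *)
Lemma smooth_on_tder_vfield (Ve : S -> 'rV[R]_d) (F : S -> R) :
  smooth_vfield Ve -> smooth_on setT F -> smooth_on setT (fun x => tder x (Ve x) F).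
Proof.
move=> sV sF i k; have oI := open_chart_image (S := S) (i := i) openT.
pose Vi x := tder x (Ve x) (chart (m:=S) i).
apply: (Ck_ext (f := fun q => \sum_(j < d) Vi (cinv i q) 0 j *
    'D_(delta_mx 0 j) (F \o cinv (m:=S) i) q)) => //.
  move=> _ [x [ix _] <-]; rewrite /= chartK //.
  have dF := smooth_on_differentiable sF (I : setT x) ix.
  rewrite (tder_chart _ ix dF) -/(Vi x) {2}[Vi x]row_sum_delta (deriveE _ dF) linear_sum.
  by apply: eq_bigr => j _; rewrite linearZ /= deriveE.
apply: Ck_sum => // j _; apply: Ck_mul => //; last first.
  by have [_] := sF i k.+1; exact.
have := sV i i k; rewrite setIid -{1}[cdom i]setIT => sVi.
by have /Ck_rV := sVi; exact.
Qed.

(** The chain rule, applied to the preferred chart as a function, recovers [u] from its components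
    in chart [i]. *)
Lemma chart_tder_inj i x u : cdom i x -> tder x u (chart (m:=S) i) = 0 -> u = 0.
Proof.
move=> ix u0; rewrite -[LHS](tder_chart_self x) (tder_chart _ ix) ?u0 ?derive0 //.
by apply: smooth_on_differentiable (@smooth_on_chart _ _ S _) _ ix; exact: cdom_at.
Qed.

End TangentDerivative.

(** * Bump functions and sections of Lie algebroids *)

Section Bump.
Variables (R : realType) (d : nat) (S : manifold R d).

(** The closed set [K] inside [U] matters: mere vanishing outside [U] would not make the product
    with a function smooth on [U] alone smooth at the boundary of [U]. *)
Definition bump_in (U : set S) (psi : S -> R) : Prop :=
  smooth_on setT psi /\
  exists K, [/\ closed K, K `<=` U & forall y, ~ K y -> psi y = 0].

Lemma bump_in0 U psi y : bump_in U psi -> ~ U y -> psi y = 0.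
Proof. by move=> [_ [K [_ KU K0]]] nU; apply: K0 => /KU. Qed.

Lemma smooth_on_cutoff U psi (F : S -> R) : open U -> bump_in U psi ->
  smooth_on U F -> smooth_on setT (fun y => psi y * F y).
Proof.
move=> oU [sp [K [cK KU K0]]] sF; apply: smooth_on_cover => x _.
have [Ux|nUx] := pselect (U x).
  by exists U; split => //; apply: smooth_on_mul => //; exact: smooth_on_sub sp.
exists (~` K); split; first by move=> /KU.
apply: (smooth_on_ext (F := fun=> 0)); first exact: closed_openC.
  by move=> y /K0 ->; rewrite mul0r.
exact: smooth_on_cst.
Qed.

(** In the preferred chart, a flat function of [rho^2] minus the squared distance to [p], normalized
    at the centre and extended by 0. *)
Lemma bump_exists (U : set S) x : open U -> U x ->
  exists psi, bump_in U psi /\ psi x = 1.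
Proof.
move=> oU Ux; pose c := chart_at x; pose p := chart c x.
have cx : cdom c x := cdom_at x.
have [e /= e0 eV] : nbhs_ball p (chart c @` (cdom c `&` U)).
  apply/nbhs_ballP; apply: open_nbhs_nbhs; split; first exact: open_chart_image.
  by exists x.
pose rho := e / 2; have rho0 : 0 < rho by rewrite divr_gt0.
(* The norm of the library is the sup norm; the Euclidean square is polynomial, hence smooth, and
   the closed Euclidean ball of radius [rho] lies in the sup-norm ball of radius [e]. *)
pose nrm (q : 'rV[R]_d) := \sum_j (q 0 j - p 0 j) * (q 0 j - p 0 j).
pose Kq := [set q | nrm q <= rho ^+ 2].
have Kqj q j : Kq q -> `|q 0 j - p 0 j| <= rho.
  move=> Kqq; rewrite -(@ler_pXn2r _ 2) ?nnegrE ?(ltW rho0) // real_normK ?num_real //.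
  apply: le_trans Kqq; rewrite /nrm (bigD1 j) //= expr2 lerDl.
  by apply: sumr_ge0 => ? _; rewrite -expr2; exact: sqr_ge0.
have Kqb q : Kq q -> ball p e q.
  move=> Kqq; rewrite -ball_normE /= [ltLHS]/Num.Def.normr/= mx_normrE.
  apply: (@le_lt_trans _ _ rho); last by rewrite ltr_pdivrMr // mulr_natr mulr2n ltrDl.
  rewrite bigmax_le ?(ltW rho0) //= => -[i j] _.
  by rewrite !mxE ord1 distrC Kqj.
have nrm_cont : continuous nrm.
  suff h : Ck 0 setT nrm by move=> q; exact: h.
  have cj j : Ck 0 [set: 'rV[R]_d] (fun q : 'rV[R]_d => q 0 j - p 0 j).
    by apply: Ck_add => //; [exact: openT | move=> q _;
      exact: coord_continuous | exact: Ck_cst].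
  apply: Ck_sum; first exact: openT.
  by move=> j _; apply: Ck_mul => //; exact: openT.
have Kqc : compact Kq.
  apply: bounded_closed_compact.
    exists (`|p| + e); split; first by rewrite num_real.
    move=> M ltM q Kqq; apply: le_trans (ltW ltM); rewrite -[q](subrK p) addrC.
    apply: le_trans (ler_normD _ _) _; rewrite lerD2l distrC ltW //.
    by have := Kqb _ Kqq; rewrite -ball_normE.
  apply: (@preimage_closed _ _ nrm [set r | r <= rho ^+ 2]); last exact: closed_le.
  by move=> q _; exact: nrm_cont.
pose K := cinv c @` Kq.
have KqV q : Kq q -> (chart c @` (cdom c `&` U)) q by move=> /Kqb; exact: eV.
(* A compact subset of a Hausdorff space is closed. Closedness relative to the chart domain would
   not allow the extension by 0. *)
have cK : closed K.
  apply: compact_closed; first exact: mf_hausdorff.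
  apply: continuous_compact => //; apply: continuous_in_subspaceT => q.
  rewrite inE => /KqV[y [cy _] <-]; apply: cinv_continuous; by exists y.
have KU : K `<=` cdom c `&` U.
  by move=> _ [q /KqV[y [cy Uy] <-] <-]; rewrite chartK.
pose b y := flat 0 (rho ^+ 2 - nrm (chart c y)) / flat 0 (rho ^+ 2).
pose psi y := if `[< cdom c y >] then b y else 0.
have psi0 y : ~ K y -> psi y = 0.
  move=> nK; rewrite /psi; case: asboolP => // cy.
  rewrite /b /flat [X in if X then _ else _](_ : _ = false) ?mul0r //.
  apply/negP; rewrite subr_gt0 => h; apply: nK; exists (chart c y); last exact: chartK.
  exact: ltW.
exists psi; split; last first.
  rewrite /psi asboolT // /b (_ : nrm _ = 0) ?subr0.
    by rewrite divff // /flat exprn_gt0 // mulf_neq0 ?invr_eq0 ?expf_neq0 ?gt_eqF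
      ?expR_gt0.
  by rewrite /nrm big1 // => j _; rewrite subrr mulr0.
split; last by exists K; split=> // y /KU[].
apply: smooth_on_cover => y _; have [cy|ncy] := pselect (cdom c y); last first.
  exists (~` K); split; first by move=> /KU[].
  apply: (smooth_on_ext (F := fun=> 0)); first exact: closed_openC.
    by move=> z /psi0 ->.
  exact: smooth_on_cst.
have oc : open (cdom c) := cdom_open c.
exists (cdom c); split => //; apply: (smooth_on_ext (F := b)) => //.
  by move=> z cz; rewrite /psi asboolT.
apply: smooth_on_mul => //; last exact: smooth_on_cst.
apply: smooth_on_flat => //; apply: smooth_on_add => //; first exact: smooth_on_cst.
apply: smooth_on_opp => //; apply: smooth_on_sum => // j _.
have sj : smooth_on (cdom c) (fun z : S => chart c z 0 j - p 0 j).
  apply: smooth_on_add => //; last exact: smooth_on_cst.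
  by have /smooth_on_rV := @smooth_on_chart _ _ S c; exact.
exact: smooth_on_mul.
Qed.

End Bump.

(** * Global sections of [A] and of the kernel of the anchor *)

Section Sections.
Variables (R : realType) (d : nat) (S : manifold R d) (r : nat).

Section VBundle.
Variable A : vbundle S r.

Lemma smooth_section_scale (phi : S -> R) (X : forall x, A x) :
  smooth_on setT phi -> smooth_section X -> smooth_section (fun y => phi y *: X y).
Proof.
move=> sphi sX i; have oi : open (tdom i) := tdom_open i.
have /smooth_on_rV -/(_ oi) h := sX i; apply/smooth_on_rV => // j.
apply: (smooth_on_ext (F := fun y => phi y * triv i y (X y) 0 j)) => //.
  by move=> y _; rewrite linearZ mxE.
by apply: smooth_on_mul => //; exact: smooth_on_sub sphi.
Qed.

Lemma smooth_section_add (X Y : forall x, A x) :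
  smooth_section X -> smooth_section Y -> smooth_section (fun y => X y + Y y).
Proof.
move=> sX sY i; have oi : open (tdom i) := tdom_open i.
apply: (smooth_on_ext (F := fun y => triv i y (X y) + triv i y (Y y))) => //.
  by move=> y _; rewrite linearD.
exact: smooth_on_add.
Qed.

Lemma smooth_section_sum (I : Type) (s : seq I) (X : I -> forall x, A x) :
  (forall k, smooth_section (X k)) -> smooth_section (fun y => \sum_(k <- s) X k y).
Proof.
move=> sX i; have oi : open (tdom i) := tdom_open i.
apply: (smooth_on_ext (F := fun y => \sum_(k <- s) triv i y (X k y))) => //.
  by move=> y _; rewrite linear_sum.
by apply: smooth_on_sum => // k _; exact: sX.
Qed.

(** Constant components in a trivialization, cut off by a bump function. Brackets take global
    sections, so every element of a fibre has to be extended in this way. *)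
Lemma section_through x (a : A x) : exists X : forall x, A x, smooth_section X /\ X x = a.
Proof.
have [i ix] := tdom_cover A x; have oi : open (tdom i) := tdom_open i.
have [psi [bp p1]] := bump_exists oi ix.
exists (fun y => psi y *: tinv i y (triv i x a)).
split; last by rewrite p1 scale1r trivK.
move=> j; have oj : open (tdom j) := tdom_open j.
apply/smooth_on_rV => // k.
pose F (y : S) := triv j y (tinv i y (triv i x a)) 0 k.
apply: (smooth_on_ext (F := fun y => psi y * F y)) => //.
  by move=> y _; rewrite linearZ mxE.
have oij : open (tdom i `&` tdom j) by exact: openI.
have sF : smooth_on (tdom i `&` tdom j) F.
  by have /smooth_on_rV -/(_ oij) := triv_smooth i j (triv i x a); exact.
have [sp [K [cK KU K0]]] := bp.
apply: smooth_on_cover => y jy; have [iy|niy] := pselect (tdom i y).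
  exists (tdom i `&` tdom j); split=> //; apply: smooth_on_mul => //.
  exact: smooth_on_sub sp.
exists (~` K); split; first by move=> /KU.
apply: (smooth_on_ext (F := fun=> 0)); first exact: closed_openC.
  by move=> z /K0 ->; rewrite mul0r.
exact: smooth_on_cst.
Qed.

End VBundle.

Variable A : lieAlgebroid S r.
Hypothesis anchor_onto : forall x u, exists a, anchor A x a = u.

Definition anchor_comp (X : forall x, A x) i (y : S) : 'rV[R]_d :=
  tder y (anchor A y (X y)) (chart (m:=S) i).

Lemma anchor_comp_smooth X i j : smooth_section X ->
  smooth_on (cdom i) (fun y => anchor_comp X i y 0 j).
Proof.
move=> sX; have oi : open (cdom i) := cdom_open i.
have /(_ i)/smooth_on_rV -/(_ oi) := anchor_smooth sX; exact.
Qed.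

Lemma tdiff_chart i y : cdom i y -> tdiff y (chart (m:=S) i).
Proof. exact: smooth_on_tdiff (@smooth_on_chart _ _ S i). Qed.

Lemma anchor_frame x : exists X : 'I_d -> forall x, A x,
  (forall k, smooth_section (X k)) /\ forall k, anchor A x (X k x) = delta_mx 0 k.
Proof.
have /choice[a ha] : forall k : 'I_d, exists a, anchor A x a = delta_mx 0 k.
  by move=> k; exact: anchor_onto.
have /choice[X hX] : forall k : 'I_d, exists X :
  forall x, A x, smooth_section X /\ X x = a k.
  by move=> k; exact: section_through.
exists X; split=> k; first exact: (hX k).1.
by rewrite (hX k).2.
Qed.

(* Cramer's rule removes the anchor of an arbitrary extension of a without
   inverting the matrix of a local frame. *)
Lemma kernel_section x (a : A x) : anchor A x a = 0 ->
  exists Y : forall x, A x, [/\ smooth_section Y, forall y,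
    anchor A y (Y y) = 0 & Y x = a].
Proof.
move=> a0; have [X [sX Xx]] := anchor_frame x.
have [Y0 [sY0 Y0x]] := section_through a.
pose c := chart_at x; have cx : cdom c x := cdom_at x.
have oc : open (cdom c) := cdom_open c.
have [psi [bp p1]] := bump_exists oc cx.
pose P y := \matrix_k anchor_comp (X k) c y.
have sP : forall i j, smooth_on (cdom c) (fun y => P y i j).
  move=> i j; apply: (smooth_on_ext (F := fun y => anchor_comp (X i) c y 0 j)) => //.
    by move=> y _; rewrite mxE.
  exact: anchor_comp_smooth.
pose g k y := psi y * - (anchor_comp Y0 c y *m \adj (P y)) 0 k.
have sg k : smooth_on setT (g k).
  apply: smooth_on_cutoff bp _ => //; apply: smooth_on_opp => //.
  apply: (smooth_on_ext (F := fun y => \sum_j anchor_comp Y0 c y 0 j * cofactor (P y)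
    k j)) => //.
    by move=> y _; rewrite mxE; apply: eq_bigr => j _; rewrite mxE.
  apply: smooth_on_sum => // j _; apply: smooth_on_mul => //;
    first exact: anchor_comp_smooth.
  exact: smooth_on_cofactor.
pose Y y := (psi y * \det (P y)) *: Y0 y + \sum_k g k y *: X k y.
exists Y; split.
- apply: smooth_section_add.
    apply: smooth_section_scale => //; apply: smooth_on_cutoff bp _ => //.
    exact: smooth_on_det.
  by apply: smooth_section_sum => k; exact: smooth_section_scale.
- move=> y; have [cy|ncy] := pselect (cdom c y); last first.
    rewrite /Y (bump_in0 bp ncy) mul0r scale0r add0r big1 ?linear0 // => k _.
    by rewrite /g (bump_in0 bp ncy) mul0r scale0r.
  apply: (chart_tder_inj cy); have dc := tdiff_chart cy.
  rewrite /Y linearD linear_sum linearZ /= tder_linear // tder_sum //.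
  under eq_bigr do rewrite linearZ /= tderZ //.
  have -> : \sum_i g i y *: tder y (anchor A y (X i y)) (chart c)
     = (- psi y) *: (anchor_comp Y0 c y *m \adj (P y)) *m P y.
    rewrite mulmx_sum_row; apply: eq_bigr => k _.
    by rewrite rowK mxE /g mulrN mulNr.
  by rewrite -scalemxAl -mulmxA mul_adj_mx mul_mx_scalar scalerA mulNr scaleNr addrN.
- have P1 : P x = 1%:M.
    by apply/row_matrixP => k; rewrite rowK row1 /anchor_comp Xx tder_chart_self.
  have c0 : anchor_comp Y0 c x = 0 by rewrite /anchor_comp Y0x a0 tder0.
  rewrite /Y P1 det1 p1 mulr1 scale1r Y0x big1 ?addr0 // => k _.
  by rewrite /g c0 mul0mx mxE oppr0 mulr0 scale0r.
Qed.

Lemma bracketD_r X Y Z : smooth_section X -> smooth_section Y -> smooth_section Z ->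
  forall x, bracket Z (fun y => X y + Y y : A y) x = bracket Z X x + bracket Z Y x.
Proof.
move=> sX sY sZ x; have -> : (fun y => X y + Y y) = (fun y => 1 *: X y + Y y).
  by apply: functional_extensionality_dep => y; rewrite scale1r.
by rewrite bracket_linearr // scale1r.
Qed.

Lemma bracketD_l X Y Z : smooth_section X -> smooth_section Y -> smooth_section Z ->
  forall x, bracket (fun y => X y + Y y : A y) Z x = bracket X Z x + bracket Y Z x.
Proof.
move=> sX sY sZ x; have -> : (fun y => X y + Y y) = (fun y => 1 *: X y + Y y).
  by apply: functional_extensionality_dep => y; rewrite scale1r.
by rewrite bracket_linearl // scale1r.
Qed.

Lemma bracketC X Y : smooth_section X -> smooth_section Y ->
  forall x, bracket X Y x = - bracket Y X x :> A x.
Proof.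
move=> sX sY x; have sXY := smooth_section_add sX sY.
have := bracket_alt sXY x.
rewrite bracketD_l // !bracketD_r // !bracket_alt // add0r addr0 => /eqP.
by rewrite addr_eq0 => /eqP.
Qed.

(* The Jacobi identity for X, Y, phi Z, expanded by the Leibniz rule, leaves
   the single term (#[X, Y] phi) Z. *)
Lemma anchor_bracket_ker X Y x : (0 < r)%N -> smooth_section X -> smooth_section Y ->
  (forall y, anchor A y (Y y) = 0) -> anchor A x (bracket X Y x) = 0.
Proof.
move=> r0 sX sY Y0.
(* The Jacobi identity will only give a multiple of [Z x], so [Z] must not vanish at [x]; positive
   rank provides it. *)
have [Z [sZ Zx]] : exists Z : forall x, A x, smooth_section Z /\ Z x != 0.
  have [i ix] := tdom_cover A x.
  have [Z [sZ Zx]] := section_through (tinv i x (delta_mx 0 (Ordinal r0))).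
  exists Z; split=> //; rewrite Zx; apply/eqP => h.
  have : triv i x (tinv i x (delta_mx 0 (Ordinal r0))) = delta_mx 0 (Ordinal r0) by
    rewrite tinvK.
  rewrite h linear0 => /matrixP/(_ 0 (Ordinal r0)); rewrite !mxE !eqxx /= => /eqP.
  by rewrite eq_sym oner_eq0.
have sXY := bracket_smooth sX sY; have sXZ := bracket_smooth sX sZ.
have sYZ := bracket_smooth sY sZ.
have key (phi : S -> R) : smooth_on setT phi ->
    tder x (anchor A x (bracket X Y x)) phi = 0.
  move=> sphi; pose Xphi y := tder y (anchor A y (X y)) phi.
  have sXphi : smooth_on setT Xphi.
    by apply: smooth_on_tder_vfield => //; exact: anchor_smooth.
  have sphiZ := smooth_section_scale sphi sZ.
  have EYZ : bracket Y (fun y => phi y *: Z y) = fun y => phi y *: bracket Y Z y.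
    apply: functional_extensionality_dep => y.
    by rewrite bracket_leibniz // Y0 tder0 scale0r addr0.
  have EZX : bracket (fun y => phi y *: Z y) X
      = fun y => (- phi y) *: bracket X Z y + (- Xphi y) *: Z y.
    apply: functional_extensionality_dep => y.
    by rewrite bracketC // bracket_leibniz // opprD !scaleNr.
  have sNphi : smooth_on setT (fun y => - phi y) by apply: smooth_on_opp => //;
    exact: openT.
  have sNXphi : smooth_on setT (fun y => - Xphi y) by apply: smooth_on_opp => //;
    exact: openT.
  have := bracket_jacobi sX sY sphiZ x.
  rewrite EYZ EZX (bracketC sphiZ sXY) bracketD_r //; try exact: smooth_section_scale.
  rewrite !bracket_leibniz // !Y0 !tder0 !scale0r !addr0.
  have := bracket_jacobi sX sY sZ x.
  rewrite (bracketC sZ sXY); have -> : bracket Z X = fun y => -1 *: bracket X Z y.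
    by apply: functional_extensionality_dep => y; rewrite bracketC // scaleN1r.
  rewrite (@bracket_leibniz _ _ _ _ A Y (bracket X Z) (fun=> -1)) //;
    last exact: smooth_on_cst.
  rewrite tder_cst scale0r addr0 scaleN1r => /(congr1 (fun v => phi x *: v)).
  rewrite scaler0 !scalerDr !scalerN !scaleNr !opprD /Xphi.
  move=> J; rewrite [X in X + _]addrACA subrr addr0 addrA J add0r => /eqP.
  by rewrite oppr_eq0 scaler_eq0 (negbTE Zx) orbF => /eqP.
pose c := chart_at x; have cx : cdom c x := cdom_at x.
have oc : open (cdom c) := cdom_open c.
have [psi [bp p1]] := bump_exists oc cx.
set u := anchor A x _; apply/rowP => k; rewrite mxE -(tder_chart_self x u) -/c.
have dc := tdiff_chart cx; rewrite tder_rV //.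
(* The cut-off coordinate functions are global test functions that detect every component of the
   anchor. Subtracting the value at [x] removes the term in which [psi] is differentiated. *)
pose l (y : S) := chart c y 0 k - chart c x 0 k.
have sl : smooth_on (cdom c) l.
  apply: smooth_on_add => //; last exact: smooth_on_cst.
  by have /smooth_on_rV -/(_ oc) := @smooth_on_chart _ _ S c; exact.
have := key _ (smooth_on_cutoff oc bp sl).
have dl : tdiff x l := smooth_on_tdiff sl cx.
rewrite tder_mul //; last exact: smooth_on_tdiff bp.1 _.
rewrite p1 mul1r {2}/l subrr mul0r addr0 => <-.
rewrite /l tder_add ?tder_cst ?addr0 //; exact: tdiff_rV.
Qed.

End Sections.

(** * Killing fields and skew matrices *)

Section Line.
Variables (R : realType) (E : normedModType R).

Lemma differentiable_line (v q : E) (t : R) : differentiable (fun t : R => t *: v + q) t.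
Proof.
exact: (@differentiableD _ _ _ (fun t : R => t *: v) (cst q)).
Qed.

Lemma derive_line (v q : E) (t : R) : 'D_1 (fun t : R => t *: v + q) t = v.
Proof.
have dl : differentiable (fun t : R => t *: v) t by exact: differentiableZl.
rewrite (@deriveD _ _ _ (fun t : R => t *: v) (cst q)) //; last exact: diff_derivable.
rewrite derive_cst addr0 deriveE //.
by rewrite (@diff_val _ _ _ _ _ _ _ (is_diff_scalel t v)) scale1r.
Qed.

Lemma is_derive_along (W : normedModType R) (G : E -> W) (v q : E) (t : R) :
  differentiable G (t *: v + q) ->
  is_derive t (1 : R) (fun t => G (t *: v + q)) ('D_v G (t *: v + q)).
Proof.
move=> dG; pose line (t : R) := t *: v + q.
have dl : differentiable line t := differentiable_line v q t.
split; first by apply: diff_derivable; exact: (differentiable_comp dl dG).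
have := derive_comp (1 : R) dl dG; rewrite derive_line; exact.
Qed.

End Line.

Section Dot.
Variables (R : realType) (n : nat).
Implicit Types u v w : 'rV[R]_n.

Lemma dotC u v : dot u v = dot v u.
Proof. by apply: eq_bigr => i _; rewrite mulrC. Qed.

Lemma dotE u v : dot u v = (u *m v^T) 0 0.
Proof. by rewrite mxE; apply: eq_bigr => i _; rewrite mxE. Qed.

Lemma dotDl u v w : dot (u + v) w = dot u w + dot v w.
Proof. by rewrite !dotE mulmxDl mxE. Qed.

Lemma dotZl c u v : dot (c *: u) v = c * dot u v.
Proof. by rewrite !dotE -scalemxAl mxE. Qed.

Lemma dotBl u v w : dot (u - v) w = dot u w - dot v w.
Proof. by rewrite dotDl -scaleN1r dotZl mulN1r. Qed.

Lemma dotDr u v w : dot u (v + w) = dot u v + dot u w.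
Proof. by rewrite dotC dotDl !(dotC u). Qed.

Lemma dotZr c u v : dot u (c *: v) = c * dot u v.
Proof. by rewrite dotC dotZl dotC. Qed.

Lemma dotBr u v w : dot u (v - w) = dot u v - dot u w.
Proof. by rewrite dotC dotBl !(dotC u). Qed.

Lemma dot0l u : dot 0 u = 0.
Proof. by rewrite /dot big1 // => i _; rewrite mxE mul0r. Qed.

Lemma dot_delta u i : dot u (delta_mx 0 i) = u 0 i.
Proof.
rewrite /dot (bigD1 i) //= big1 ?addr0; first by rewrite mxE !eqxx mulr1.
by move=> j ji; rewrite mxE (negbTE ji) andbF mulr0.
Qed.

Lemma dot_ge0 u : 0 <= dot u u.
Proof. by apply: sumr_ge0 => i _; rewrite -expr2 sqr_ge0. Qed.

Lemma dot_eq0 u : dot u u = 0 -> u = 0.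
Proof.
move=> /psumr_eq0P h; apply/rowP => i; rewrite mxE.
have := h (fun i _ => sqr_ge0 (u 0 i)) i isT.
by move=> /eqP; rewrite mulf_eq0 orbb => /eqP.
Qed.

Lemma dot_ext u v : (forall w, dot u w = dot v w) -> u = v.
Proof. by move=> h; apply/rowP => i; rewrite -!dot_delta h. Qed.

End Dot.

Section KillingFields.
Variables (R : realType) (n : nat).
Implicit Types (X Y : vfield R n) (p q m : 'rV[R]_n).

(** Row [i] is the image of the basis vector [i], as matrices act on rows from the right.
    Differences of values, instead of derivatives, make [lin] linear on all vector fields and reduce
    its smooth dependence on parameters to that of evaluations. *)
Definition lin X : 'M[R]_n := \matrix_i (X (delta_mx 0 i) - X 0).

Lemma killing_differentiable X p : killing X -> differentiable (X :
  'rV[R]_n -> 'rV[R]_n) p.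
Proof. by move=> [sX _]; have [+ _] := sX 1; apply. Qed.

(** Along the line in direction [v = p - q], the function [X . v] has derivative ['D_v X . v], which
    the Killing equation with both vectors equal to [v] makes zero. *)
Lemma killing_diff_orth X p q : killing X -> dot (X p - X q) (p - q) = 0.
Proof.
move=> kX; have [_ kX2] := kX; set v := p - q.
pose f (z : 'rV[R]_n) := dot (X z) v.
have fE : f = \sum_(j < n) (fun z => v 0 j *: (X z 0 j : R)).
  by apply/funext => z; rewrite fct_sumE /f /dot; apply: eq_bigr => j _; rewrite mulrC.
have dXj z j : differentiable (fun z => X z 0 j : R) z.
  by apply: differentiable_rV_coord; exact: killing_differentiable.
have df z : differentiable f z.
  by rewrite fE; apply: differentiable_sum => j; apply: differentiableZ; exact: dXj.
have Df z : 'D_v f z = 0.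
  rewrite fE derive_sum; last by move=> j; apply: diff_derivable;
    apply: differentiableZ; exact: dXj.
  rewrite (eq_bigr (fun j => v 0 j * 'D_v (fun z => X z 0 j : R) z)); last first.
    by move=> j _; rewrite deriveZ //; apply: diff_derivable; exact: dXj.
  have := kX2 z v v; rewrite (dotC v) -mulr2n => /eqP; rewrite mulrn_eq0 /= => /eqP h0.
  rewrite -[RHS]h0; apply: eq_bigr => j _; rewrite mulrC derive_mx ?mxE //.
  by apply: diff_derivable; exact: killing_differentiable.
pose g (t : R) : 'rV[R]_n := t *: v + q.
have dfg (t : R) : is_derive t (1 : R) (f \o g : R -> R) 0.
  by rewrite -(Df (g t)); exact: is_derive_along.
have := is_derive_0_is_cst 1 0 dfg.
rewrite /g /f /= scale1r scale0r add0r subrK => h.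
by rewrite dotBl h subrr.
Qed.

(** Polarization of [killing_diff_orth]: the instances at [p, 0] and at [q, 0] remove the diagonal
    terms. *)
Lemma killing_dot0 X p q : killing X -> dot (X p - X 0) q + dot (X q - X 0) p = 0.
Proof.
move=> kX; have h0 z : dot (X z - X 0) z = 0.
  by have := killing_diff_orth z 0 kX; rewrite subr0.
have := killing_diff_orth p q kX.
rewrite -[X p - X q](subrKA (X 0)) -[X 0 - X q]opprB dotBl !dotBr !h0 sub0r subr0 => /eqP.
by rewrite -opprD oppr_eq0 => /eqP.
Qed.

(** Skewness forces linearity: [(X p - X 0) . e_j = - (X e_j - X 0) . p], and the right-hand side is
    linear in [p]. *)
Lemma linE X p : killing X -> X p = p *m lin X + X 0.
Proof.
move=> kX; apply/eqP; rewrite -subr_eq; apply/eqP; apply/rowP => j.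
rewrite -dot_delta; have /eqP := killing_dot0 p (delta_mx 0 j) kX.
rewrite addr_eq0 => /eqP ->; rewrite dotC {1}[p]row_sum_delta.
rewrite mxE /dot -sumrN; apply: eq_bigr => i _.
rewrite summxE (bigD1 i) //= big1 ?addr0; last first.
  by move=> k ki; rewrite !mxE eq_sym (negbTE ki) andbF mulr0.
rewrite mxE [delta_mx _ _ _ _]mxE !eqxx mulr1 -mulrN; congr (_ * _).
rewrite [RHS]mxE -!dot_delta; apply/eqP.
by rewrite eq_sym -addr_eq0; apply/eqP; exact: killing_dot0.
Qed.

Lemma lin_skew X : killing X -> (lin X)^T = - lin X.
Proof.
move=> kX; apply/matrixP => i j; rewrite !mxE; apply/eqP; rewrite -addr_eq0.
have := killing_dot0 (delta_mx 0 i) (delta_mx 0 j) kX.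
by rewrite !dot_delta !mxE => h; apply/eqP; rewrite -[RHS]h; ring.
Qed.

Lemma lin_linear : linear lin.
Proof. move=> c X Y; apply/matrixP => i j; rewrite [LHS]mxE.
set e := delta_mx 0 i; transitivity ((c *: X e + Y e - (c *: X 0 + Y 0)) 0 j) => //.
by rewrite !mxE; ring. Qed.

HB.instance Definition _ := GRing.isLinear.Build R _ _ _ lin lin_linear.

Lemma killing_const (b : 'rV[R]_n) : killing (const_field b).
Proof.
split=> [k|m u v]; first exact: Ck_cst.
have E w : 'D_w (const_field b) m = (0 : 'rV[R]_n) by exact: derive_cst.
by rewrite !E dot0l add0r dotC dot0l.
Qed.

Lemma killing_sub X Y : killing X -> killing Y -> killing (X - Y).
Proof.
move=> kX kY; split=> [k|m u v].
  have sY : Ck k setT (fun z => (-1 : R) *: (Y z)).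
    have oT : open [set: 'rV[R]_n] := openT.
    apply/Ck_rV => // j; apply: (Ck_ext (f := fun z => -1 * Y z 0 j)) => //.
      by move=> z _; rewrite mxE.
    apply: Ck_mul => //; first exact: Ck_cst.
    by have /Ck_rV -/(_ oT) := kY.1 k; exact.
  apply: (Ck_ext (f := fun z => X z + -1 *: Y z)); first exact: openT.
    by move=> z _; rewrite scaleN1r.
  by apply: Ck_add => //; [exact: openT | exact: kX.1].
have dX := killing_differentiable m kX; have dY := killing_differentiable m kY.
have E w : 'D_w (X - Y) m = 'D_w X m - 'D_w Y m.
  by rewrite deriveB //; exact: diff_derivable.
rewrite !E dotBl dotBr; have := kX.2 m u v; have := kY.2 m u v.
by move=> hY hX; rewrite addrACA -opprD hX hY subrr.
Qed.

Lemma killing_derive X m u : killing X -> 'D_u X m = u *m lin X.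
Proof.
move=> kX; have -> : X = (fun z => z *m lin X + X 0).
  by apply/funext => z; exact: linE.
have dl z : differentiable (mulmxr (lin X) : 'rV[R]_n -> 'rV[R]_n) z.
  apply: differentiable_rV => j.
  have -> : (fun y => mulmxr (lin X) y 0 j) = \sum_(i < n) (fun y :
    'rV[R]_n => lin X i j *: (y 0 i : R)).
    by apply/funext => y; rewrite fct_sumE mxE; apply: eq_bigr => i _; rewrite mulrC.
  by apply: differentiable_sum => i; apply: differentiableZ; exact: differentiable_coord.
have -> : lin (fun z => z *m lin X + X 0) = lin X.
  by apply/matrixP => i j; rewrite mxE -rowE mul0mx add0r addrK mxE.
rewrite (@deriveD _ _ _ (mulmxr (lin X)) (cst (X 0))) //; last exact: diff_derivable.
rewrite derive_cst addr0 deriveE // diff_lin // => z.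
exact: differentiable_continuous.
Qed.

End KillingFields.

(** * Generators of so(n) and its first cohomology *)

Section Skew.
Variables (R : realType) (n : nat).
Implicit Types (i j k l : 'I_n) (p m : 'rV[R]_n) (B : 'M[R]_n).

Definition rot i j : 'M[R]_n := delta_mx i j - delta_mx j i.

Lemma rot_skew i j : (rot i j)^T = - rot i j.
Proof. by rewrite /rot linearB /= !trmx_delta opprB. Qed.

Lemma rotC i j : rot i j = - rot j i.
Proof. by rewrite /rot opprB. Qed.

Lemma mul_rotE p i j l :
  (p *m rot i j) 0 l = p 0 i * (j == l)%:R - p 0 j * (i == l)%:R.
Proof.
rewrite /rot mulmxBr !mxE; congr (_ - _).
  rewrite (bigD1 i) //= big1 ?addr0 => [|k ki]; first by rewrite !mxE eqxx eq_sym.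
  by rewrite !mxE (negbTE ki) mulr0.
rewrite (bigD1 j) //= big1 ?addr0 => [|k ki]; first by rewrite !mxE eqxx eq_sym.
by rewrite !mxE (negbTE ki) mulr0.
Qed.

(** The sum runs over ordered pairs, so each coordinate plane occurs twice; hence the division by
    2. *)
Lemma skew_rot B : B^T = - B -> B = \sum_i \sum_j (B i j / 2) *: rot i j.
Proof.
move=> sB; have sBE i j : B j i = - B i j.
  by have := congr1 (fun M : 'M[R]_n => M i j) sB; rewrite !mxE.
apply/matrixP => k l; rewrite summxE.
have E i : (\sum_j (B i j / 2) *: rot i j) k l
    = \sum_j (B i j / 2) * ((k == i)%:R * (l == j)%:R - (k == j)%:R * (l == i)%:R).
  by rewrite summxE; apply: eq_bigr => j _; rewrite !mxE -!natrM !mulnb.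
under eq_bigr do rewrite E.
have F i : \sum_j (B i j / 2) * ((k == i)%:R * (l == j)%:R - (k == j)%:R * (l == i)%:R)
   = (k == i)%:R * (B i l / 2) - (l == i)%:R * (B i k / 2).
  under eq_bigr do rewrite mulrBr.
  rewrite sumrB; congr (_ - _).
    rewrite (bigD1 l) //= big1 ?addr0 => [|j jl]; first by rewrite eqxx mulr1 mulrC.
    by rewrite [l == j]eq_sym (negbTE jl) !mulr0.
  rewrite (bigD1 k) //= big1 ?addr0 => [|j jk]; first by rewrite eqxx mul1r mulrC.
  by rewrite [k == j]eq_sym (negbTE jk) mul0r mulr0.
under eq_bigr do rewrite F.
rewrite sumrB (bigD1 k) //= big1 ?addr0 => [|i ik];
  last by rewrite eq_sym (negbTE ik) mul0r.
rewrite (bigD1 l) //= big1 ?addr0 => [|i il]; last by rewrite eq_sym (negbTE il) mul0r.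
by rewrite !eqxx !mul1r [B l k]sBE; field.
Qed.

Hypothesis n2 : (2 <= n)%N.

Lemma other i : exists j, j != i.
Proof.
have n0 : (0 < n)%N by exact: ltn_trans n2.
have [i0|i0] := eqVneq i (Ordinal n0); last by exists (Ordinal n0); rewrite eq_sym.
by exists (Ordinal n2); rewrite i0.
Qed.

(** For [n >= 2] no nonzero vector is annihilated by all of so(n). This gives the uniqueness of the
    common zero, and later allows a factor [B] to be cancelled in the derivative of the
    primitive. *)
Lemma skew_cancel p : (forall B, B^T = - B -> p *m B = 0) -> p = 0.
Proof.
move=> h; apply/rowP => i; rewrite mxE; have [j ji] := other i.
have := congr1 (fun v : 'rV[R]_n => v 0 j) (h _ (rot_skew i j)).
by rewrite mul_rotE mxE eqxx eq_sym (negbTE ji) mulr0 subr0 mulr1.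
Qed.

(* H^1(so(n), R^n) = 0, in coordinates. *)
Lemma rot_cocycle (tau : 'I_n -> 'I_n -> 'rV[R]_n) :
  (forall i j, tau j i = - tau i j) ->
  (forall i j k, i != j -> j != k -> i != k ->
    tau i k = tau i j *m rot j k - tau j k *m rot i j) ->
  exists m, forall i j, m *m rot i j + tau i j = 0.
Proof.
move=> tauC tauB.
have tauE i j k l : i != j -> j != k -> i != k -> tau i k 0 l =
    tau i j 0 j * (k == l)%:R - tau i j 0 k * (j == l)%:R
    - (tau j k 0 i * (j == l)%:R - tau j k 0 j * (i == l)%:R).
  have subE (u v : 'rV[R]_n) : (u - v) 0 l = u 0 l - v 0 l by rewrite !mxE.
  by move=> ij jk ik; rewrite {1}(tauB i j k) // subE !mul_rotE.
have tauCE i j l : tau j i 0 l = - tau i j 0 l by rewrite tauC mxE.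
have /choice[s sP] := other.
(* Forced: component [i] of the equation for the pair [i, k] reads [m 0 k = tau i k 0 i]. By [mE]
   every [i != k] gives the same value as the chosen [s k]. *)
pose m : 'rV[R]_n := \row_k tau (s k) k 0 (s k).
have mE i k : i != k -> tau i k 0 i = m 0 k.
  move=> ik; rewrite mxE; have [->//|is_] := eqVneq i (s k).
  rewrite (tauE i (s k) k i) // eqxx [k == i]eq_sym (negbTE ik).
  by rewrite [s k == i]eq_sym (negbTE is_) !mulr0 !sub0r mulr1 oppr0 add0r opprK.
(* The three cyclic instances of the cocycle relation form an invertible linear system for the
   components of [tau] outside their own planes. *)
have t0 i j k : i != j -> j != k -> i != k -> tau i k 0 j = 0.
  move=> ij jk ik; have ji : j != i by rewrite eq_sym.
  have kj : k != j by rewrite eq_sym.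
  have ki : k != i by rewrite eq_sym.
  have := tauE i j k j ij jk ik; rewrite eqxx (negbTE kj) (negbTE ij).
  have := tauE j k i k jk ki ji; rewrite eqxx (negbTE ik) (negbTE jk).
  have := tauE k i j i ki ij kj; rewrite eqxx (negbTE ji) (negbTE ki).
  rewrite (tauCE i k j) (tauCE j k i) (tauCE i j k) !mulr0 !mulr1.
  by move: (tau i k 0 j) (tau j k 0 i) (tau i j 0 k) => a b c; lra.
exists m => i k; apply/rowP => l; rewrite mxE mul_rotE [RHS]mxE.
have [<-|ik] := eqVneq i k.
  by have := tauCE i i l; lra.
have [<-|il] := eqVneq i l.
  by rewrite mE // [k == i]eq_sym (negbTE ik) mulr0 mulr1; lra.
have [<-|kl] := eqVneq k l.
  have -> : tau i k 0 k = - m 0 i by rewrite -(mE k i) 1?eq_sym // tauCE.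
  by rewrite mulr0 mulr1; lra.
by rewrite t0 // 1?eq_sym // !mulr0; lra.
Qed.

End Skew.

(** * Dimension counts: rank-nullity and coordinates on so(n) *)

Section KernelRank.
Variables (F : fieldType) (V : lmodType F) (r d N : nat).
Variables (e : 'I_r -> V).
Hypothesis eP : forall a, exists v : 'rV[F]_r, a = \sum_k v 0 k *: e k.
Hypothesis e_free : forall v : 'rV[F]_r, \sum_k v 0 k *: e k = 0 -> v = 0.
Variables (p : {linear V -> 'rV[F]_d}) (q : {linear V -> 'rV[F]_N}).
Hypothesis p_onto : forall u, exists a, p a = u.
Hypothesis rE : r = (N + d)%N.

(** Rank-nullity: [ker p] has dimension [r - d = N], so [q] restricts to a map between spaces of
    equal dimension. Fibres are plain modules, whence the passage to matrices through the basis [e];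
    the rows of [K] below form a basis of the kernel. *)
Lemma ker_inj_surj :
  (forall a, p a = 0 -> q a = 0 -> a = 0) <-> (forall t, exists a, p a = 0 /\ q a = t).
Proof.
pose P : 'M[F]_(r, d) := \matrix_k p (e k).
pose Q : 'M[F]_(r, N) := \matrix_k q (e k).
pose c (v : 'rV[F]_r) := \sum_k v 0 k *: e k.
have cP v : p (c v) = v *m P.
  rewrite /c linear_sum mulmx_sum_row; apply: eq_bigr => k _.
  by rewrite linearZ rowK.
have cQ v : q (c v) = v *m Q.
  rewrite /c linear_sum mulmx_sum_row; apply: eq_bigr => k _.
  by rewrite linearZ rowK.
have c0 v : c v = 0 -> v = 0 by exact: e_free.
have rP : \rank P = d.
  apply/eqP; rewrite -[_ == _]/(row_full P) -sub1mx; apply/row_subP => i.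
  have [a <-] := p_onto (row i 1%:M); have [v ->] := eP a.
  by rewrite cP submxMl.
pose K := row_base (kermx P).
have rK : \rank (kermx P) = N by rewrite mxrank_ker rP rE addnK.
have KP : K *m P = 0.
  by apply/sub_kermxP; rewrite eq_row_base.
have kerK v : v *m P = 0 -> exists u, v = u *m K.
  by move=> /sub_kermxP; rewrite -(eq_row_base (kermx P)) => /submxP.
have freeK : row_free K by exact: row_base_free.
split=> h.
- have fKQ : row_free (K *m Q).
    apply/inj_row_free => u; rewrite mulmxA => uKQ.
    have /c0 : c (u *m K) = 0.
      by apply: h; [rewrite cP -mulmxA KP mulmx0 | rewrite cQ].
    by move/(congr1 (mulmxr (pinvmx K))); rewrite /= mul0mx mulmxKp.
  have /submx_full full : row_full (K *m Q).
    by rewrite /row_full; move: fKQ; rewrite /row_free => /eqP ->; rewrite rK.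
  move=> t; have /submxP[u ->] := full _ t.
  exists (c (u *m K)); split; first by rewrite cP -mulmxA KP mulmx0.
  by rewrite cQ mulmxA.
- have fKQ : row_full (K *m Q).
    rewrite -sub1mx; apply/row_subP => i.
    have [a [pa <-]] := h (row i 1%:M); have [v va] := eP a.
    move: pa; rewrite va -/(c v) cP cQ => /kerK[u ->].
    by rewrite -mulmxA submxMl.
  have rKQ : row_free (K *m Q).
    by rewrite /row_free; move: fKQ; rewrite /row_full => /eqP ->; rewrite rK.
  move=> a pa qa; have [v va] := eP a; move: pa qa;
    rewrite va -/(c v) cP cQ => /kerK[u ->].
  rewrite -mulmxA -[X in _ = X](mul0mx _ (K *m Q)) => /(row_free_inj rKQ) ->.
  by rewrite mul0mx /c big1 // => k _; rewrite mxE scale0r.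
Qed.

End KernelRank.

Section SkewCoordinates.
Variables (R : realType) (n : nat).

(** These are the positions above the diagonal, so [#|pairs|] is the dimension of so(n). Taking the
    cardinal itself as dimension postpones the division by 2 to the final arithmetic. *)
Definition pairs : {set 'I_n * 'I_n} := [set ij : 'I_n * 'I_n | (ij.1 < ij.2)%N].

Definition skew_coord (B : 'M[R]_n) : 'rV[R]_#|pairs| :=
  \row_k B (enum_val k).1 (enum_val k).2.

Lemma skew_coord_linear : linear skew_coord.
Proof. by move=> c B C; apply/rowP => k; rewrite !mxE. Qed.

HB.instance Definition _ :=
  GRing.isLinear.Build R _ _ _ skew_coord skew_coord_linear.

Lemma skew_coord_inj (B C : 'M[R]_n) : B^T = - B -> C^T = - C ->
  skew_coord B = skew_coord C -> B = C.
Proof.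
move=> sB sC h.
have hij (i j : 'I_n) : (i < j)%N -> B i j = C i j.
  move=> ij; have ijP : (i, j) \in pairs by rewrite inE.
  have := congr1 (fun v : 'rV[R]__ => v 0 (enum_rank_in ijP (i, j))) h.
  by rewrite !mxE enum_rankK_in.
have skE (D : 'M[R]_n) : D^T = - D -> forall i j, D i j = - D j i.
  by move=> sD i j; have := congr1 (fun M : 'M[R]_n => M j i) sD; rewrite !mxE.
apply/matrixP => i j; case: (ltngtP i j) => [|ji|/val_inj ->]; first exact: hij.
  by rewrite skE // [RHS]skE // hij.
by have := skE _ sB j j; have := skE _ sC j j; lra.
Qed.

(** The index square splits into the diagonal and two triangles exchanged by transposition. *)
Lemma card_pairs : (#|pairs| * 2 + n = n * n)%N.
Proof.
have c1 : #|[set ij : 'I_n * 'I_n | (ij.2 < ij.1)%N]%SET| = #|pairs|.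
  have inj2 : injective (fun u : 'I_n * 'I_n =>
    (u.2, u.1)) by move=> [a b] [a' b'] [-> ->].
  rewrite -(card_imset pairs inj2); apply: eq_card => -[i j].
  rewrite inE /=; apply/idP/imsetP => [ij|[[a b]]].
    by exists (j, i) => //; rewrite inE.
  by rewrite inE /= => ab [-> ->].
have c2 : #|[set ij : 'I_n * 'I_n | ij.1 == ij.2]%SET| = n.
  have inj : injective (fun i : 'I_n => (i, i)) by move=> i j [].
  rewrite -[RHS]card_ord -cardsT -(card_imset _ inj); apply: eq_card => -[i j].
  rewrite inE /=; apply/eqP/imsetP => [->|[k _ [-> ->]]] //.
  by exists j.
have cardE (P : pred ('I_n * 'I_n)) : (\sum_ij P ij = #|[set ij | P ij]%SET|)%N.
  by rewrite -sum1dep_card [RHS]big_mkcond; apply: eq_bigr => ij _; case: (P ij).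
have -> : (n * n = \sum_(ij : 'I_n * 'I_n) 1)%N by rewrite sum1_card card_prod card_ord.
rewrite (eq_bigr (fun ij : 'I_n * 'I_n =>
    ((ij.1 < ij.2)%N + (ij.2 < ij.1)%N + (ij.1 == ij.2))%N)); last first.
  by move=> [i j] _ /=; rewrite -val_eqE /=; case: ltngtP.
rewrite !big_split /= (cardE (fun ij : 'I_n * 'I_n =>
  ij.1 < ij.2)%N) (cardE (fun ij : 'I_n * 'I_n => ij.2 < ij.1)%N).
by rewrite (cardE (fun ij : 'I_n * 'I_n => ij.1 == ij.2)) c1 c2 muln2 addnn.
Qed.

End SkewCoordinates.

(** * The primitive *)

Section Isotropy.
Variables (R : realType) (n d : nat) (S : manifold R d) (r : nat).
Variables (A : lieAlgebroid S r) (w : g_morphism n A).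
Hypothesis n2 : (2 <= n)%N.
Hypothesis anchor_onto : forall x u, exists a, anchor A x a = u.
Hypothesis w_inj : forall x, injective (w x).
Hypothesis rE : r = (#|pairs n| + d)%N.
Implicit Types (x y : S) (m p : 'rV[R]_n).

(* Equivalently, [isotropy w x] contains no nonzero translation. *)
Definition lin_inj x := forall a, anchor A x a = 0 -> lin (w x a) = 0 -> a = 0.

Definition fixes x m := forall a, anchor A x a = 0 -> w x a m = 0.

Lemma wE x a p : w x a p = p *m lin (w x a) + w x a 0.
Proof. by apply: linE; exact: mor_killing. Qed.

Lemma w_skew x a : (lin (w x a))^T = - lin (w x a).
Proof. by apply: lin_skew; exact: mor_killing. Qed.

Lemma w_eq0 x a : w x a = 0 -> a = 0.
Proof. by move=> h; apply: w_inj; rewrite h linear0. Qed.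

(** A Killing field with a zero and no linear part is zero, and [w] is injective. *)
Lemma fixes_lin_inj x m : fixes x m -> lin_inj x.
Proof.
move=> fm a a0 l0; have := fm a a0; rewrite wE l0 mulmx0 add0r => w0.
by apply: w_eq0; apply/funext => p; rewrite wE l0 w0 mulmx0 addr0.
Qed.

Lemma basis_ex x : exists e : 'I_r -> A x,
  (forall a, exists v : 'rV[R]_r, a = \sum_k v 0 k *: e k) /\
  (forall v : 'rV[R]_r, \sum_k v 0 k *: e k = 0 -> v = 0).
Proof.
have [i ix] := tdom_cover A x.
pose e k : A x := tinv i x (delta_mx 0 k).
have eE (v : 'rV[R]_r) : triv i x (\sum_k v 0 k *: e k) = v.
  rewrite linear_sum [RHS]row_sum_delta; apply: eq_bigr => k _.
  by rewrite linearZ /= /e tinvK.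
exists e; split=> [a|v h]; last by rewrite -(eE v) h linear0.
exists (triv i x a); apply: (can_inj (trivK ix)); by rewrite eE.
Qed.

(** The anchor is onto, so by [rE] its kernel has the dimension of so(n). Surjectivity is the side
    that visibly persists at nearby points and that supplies isotropy elements with prescribed
    rotation part. *)
Lemma lin_inj_surj x : lin_inj x <->
  forall t : 'rV[R]_#|pairs n|, exists a, anchor A x a = 0 /\ skew_coord (lin (w x
    a)) = t.
Proof.
have [e [e1 e2]] := basis_ex x.
have := @ker_inj_surj R (A x) r d _ e e1 e2 (anchor A x)
  (@skew_coord R n \o (@lin R n \o w x)) (@anchor_onto x) rE.
move=> [h1 h2]; split=> [g|s].
  apply: h1 => a a0 qa; apply: g => //.
  apply: skew_coord_inj; [exact: w_skew | by rewrite linear0 oppr0 | ].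
  by rewrite -[LHS]/((@skew_coord R n \o (@lin R n \o w x)) a) qa linear0.
move=> a a0 l0; apply: (h2 s) => //=.
by rewrite l0 linear0.
Qed.

Lemma lin_onto x (B : 'M[R]_n) : lin_inj x -> B^T = - B ->
  exists a, anchor A x a = 0 /\ lin (w x a) = B.
Proof.
move=> /lin_inj_surj /(_ (skew_coord B)) [a [a0 ha]] sB.
by exists a; split=> //; apply: skew_coord_inj => //; exact: w_skew.
Qed.

Lemma lin_inj_eq x a b : lin_inj x -> anchor A x a = 0 -> anchor A x b = 0 ->
  lin (w x a) = lin (w x b) -> a = b.
Proof.
move=> g a0 b0 h; apply/eqP; rewrite -subr_eq0; apply/eqP; apply: g.
  by rewrite linearB /= a0 b0 subrr.
by rewrite !linearB /= h subrr.
Qed.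

Lemma vf_bracketE x a b m :
  vf_bracket (w x a) (w x b) m = w x a m *m lin (w x b) - w x b m *m lin (w x a).
Proof. by rewrite /vf_bracket !killing_derive //; exact: mor_killing. Qed.

Lemma nabla0 x (Xi : S -> vfield R n) : nabla x 0 Xi = 0.
Proof. by apply/funext => m; rewrite /nabla tder0. Qed.

Lemma r_gt0 : (0 < r)%N.
Proof.
rewrite rE addn_gt0; apply/orP; left; apply/card_gt0P.
have n0 : (0 < n)%N by exact: ltn_trans n2.
by exists (Ordinal n0, Ordinal n2); rewrite inE.
Qed.

(** Extend both elements to sections of [ker #]. Their bracket stays in [ker #], and with zero
    anchors the two derivative terms of the morphism identity disappear. *)
Lemma isotropy_bracket x a b : anchor A x a = 0 -> anchor A x b = 0 ->
  exists c, anchor A x c = 0 /\ w x c = vf_bracket (w x a) (w x b).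
Proof.
move=> a0 b0.
have [Y [sY Y0 Ya]] := kernel_section anchor_onto a0.
have [Z [sZ Z0 Zb]] := kernel_section anchor_onto b0.
exists (bracket Y Z x); split.
  by apply: anchor_bracket_ker => //; exact: r_gt0.
by rewrite mor_bracket // Y0 Z0 !nabla0 subrr add0r Ya Zb.
Qed.

Lemma rot_mul i j k : i != j -> j != k -> i != k ->
  rot R i j *m rot R j k - rot R j k *m rot R i j = rot R i k :> 'M[R]_n.
Proof.
move=> ij jk ik; rewrite /rot !mulmxBl !mulmxBr !mul_delta_mx_cond !eqxx.
rewrite (negbTE ij) [j == i]eq_sym (negbTE ij) [k == i]eq_sym !(negbTE ik).
rewrite (negbTE jk) [k == j]eq_sym (negbTE jk) !mulr0n !mulr1n.
by rewrite !subr0 !sub0r ?opprK.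
Qed.

Lemma lin_bracket x a b : lin (vf_bracket (w x a) (w x b)) =
  lin (w x a) *m lin (w x b) - lin (w x b) *m lin (w x a).
Proof.
apply/row_matrixP => i; rewrite rowK !vf_bracketE (wE a (delta_mx 0 i)) (wE b
  (delta_mx 0 i)).
rewrite [RHS]rowE mulmxBr !mulmxA !mulmxDl opprD addrACA opprB -[LHS]addrA -[RHS]addr0.
by congr (_ + _); rewrite subrKA subrr.
Qed.

(** Since [lin] is injective on the isotropy, lifting [rot i j] to isotropy elements respects
    brackets, so the values of the lifts at the origin form a cocycle. A point trivializing it is a
    zero of all lifts, and these span the isotropy. *)
Lemma lin_inj_fixes x : lin_inj x -> exists m, fixes x m.
Proof.
move=> g; have /choice[a aP] : forall ij : 'I_n * 'I_n, exists a,
    anchor A x a = 0 /\ lin (w x a) = rot R ij.1 ij.2.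
  by move=> ij; apply: lin_onto => //; exact: rot_skew.
pose tau i j := w x (a (i, j)) 0.
have [i j|i j k ij jk ik|m mP] := rot_cocycle n2 (tau := tau).
- rewrite /tau; have -> : a (j, i) = - a (i, j).
    apply: lin_inj_eq => //; [exact: (aP _).1|by rewrite linearN /= (aP _).1 oppr0|].
    by rewrite !linearN /= !(aP _).2 /= rotC.
  by rewrite linearN.
- have [c [c0 wc]] := isotropy_bracket (aP (i, j)).1 (aP (j, k)).1.
  have -> : tau i k = w x c 0.
    rewrite /tau; have -> : a (i, k) = c; last by [].
    apply: lin_inj_eq => //; first exact: (aP _).1.
    by rewrite wc lin_bracket !(aP _).2 /= rot_mul.
  by rewrite wc vf_bracketE !(aP _).2.
exists m => b b0; have := skew_rot (w_skew b); set B := lin (w x b) => BE.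
have -> : b = \sum_i \sum_j (B i j / 2) *: a (i, j).
  apply: lin_inj_eq => //.
    rewrite linear_sum big1 // => i _; rewrite linear_sum big1 // => j _.
    by rewrite linearZ /= (aP _).1 scaler0.
  rewrite -/B BE !linear_sum; apply: eq_bigr => i _.
  rewrite !linear_sum; apply: eq_bigr => j _.
  by rewrite !linearZ /= (aP _).2 -BE.
rewrite linear_sum fct_sumE big1 // => i _; rewrite linear_sum fct_sumE big1 // => j _.
by rewrite linearZ /= /GRing.scale /= wE (aP _).2 mP scaler0.
Qed.

(** The difference of two common zeros is annihilated by the linear parts of the isotropy, that is,
    by all of so(n). *)
Lemma fixes_uniq x m m' : lin_inj x -> fixes x m -> fixes x m' -> m = m'.
Proof.
move=> g fm fm'; apply/eqP; rewrite -subr_eq0; apply/eqP; apply: (skew_cancel n2) => B sB.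
have [a [a0 aB]] := lin_onto g sB.
have := fm a a0; have := fm' a a0; rewrite (wE a m) (wE a m') aB mulmxBl => h1 h2.
by apply/eqP; rewrite subr_eq0 -(inj_eq (addIr (w x a 0))) h1 h2.
Qed.

Lemma w_smooth X p j : smooth_section X -> smooth_on setT (fun y => w y (X y) p 0 j).
Proof.
by move=> sX; have /smooth_on_rV -/(_ openT) := mor_smooth w sX p; exact.
Qed.

Lemma lin_smooth X i j : smooth_section X ->
  smooth_on setT (fun y => lin (w y (X y)) i j).
Proof.
move=> sX; apply: (smooth_on_ext
  (F := fun y => w y (X y) (delta_mx 0 i) 0 j + - w y (X y) 0 0 j)); first exact: openT.
  by move=> y _; rewrite !mxE.
apply: smooth_on_add; [exact: openT|exact: w_smooth|].
by apply: smooth_on_opp; [exact: openT|exact: w_smooth].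
Qed.

Lemma near_neq0 (F : S -> R) x : smooth_on setT F -> F x != 0 -> \near x, F x != 0.
Proof.
move=> sF F0; have cF := smooth_on_continuous sF (I : setT x).
apply: (cF [set z : R | z != 0]); apply: open_nbhs_nbhs; split => //.
Qed.

(** By [lin_inj_surj] it suffices to preserve surjectivity: sections of [ker #] whose linear parts
    have the standard coordinates at [x] keep an invertible coordinate matrix nearby. *)
Lemma lin_inj_open : open lin_inj.
Proof.
rewrite openE => x g; rewrite /interior.
have /choice[a aP] : forall k : 'I_#|pairs n|, exists a,
    anchor A x a = 0 /\ skew_coord (lin (w x a)) = delta_mx 0 k.
  by move=> k; exact: (lin_inj_surj x).1 g _.
have /choice[Y YP] : forall k, exists Y : forall x, A x,
    [/\ smooth_section Y, forall y, anchor A y (Y y) = 0 & Y x = a k].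
  by move=> k; exact: (kernel_section anchor_onto (aP k).1).
pose M y := \matrix_k skew_coord (lin (w y (Y k y))).
have sM : smooth_on setT (fun y => \det (M y)).
  apply: smooth_on_det; first exact: openT.
  move=> k l; have [sY _ _] := YP k.
  apply: smooth_on_ext (lin_smooth (enum_val l).1 (enum_val l).2 sY); first exact: openT.
  by move=> y _; rewrite !mxE.
have M1 : M x = 1%:M.
  apply/row_matrixP => k; rewrite rowK row1; have [_ _ ->] := YP k.
  exact: (aP k).2.
near=> y; apply/lin_inj_surj => t.
have uM : M y \in unitmx.
  rewrite unitmxE unitfE; near: y; apply: near_neq0 => //.
  by rewrite M1 det1 oner_neq0.
exists (\sum_k (t *m invmx (M y)) 0 k *: Y k y); split.
  rewrite linear_sum big1 // => k _; have [_ Y0 _] := YP k.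
  by rewrite linearZ /= Y0 scaler0.
rewrite -[RHS](mulmxKV uM) [RHS]mulmx_sum_row.
rewrite -[LHS]/((@skew_coord R n \o (@lin R n \o w y)) _) linear_sum.
by apply: eq_bigr => k _; rewrite linearZ rowK.
Unshelve. all: by end_near. Qed.

End Isotropy.

(** * The common zero as a map, its smoothness and its differential *)

Section Development.
Variables (R : realType) (n d : nat) (S : manifold R d) (r : nat).
Variables (A : lieAlgebroid S r) (w : g_morphism n A).
Hypothesis n2 : (2 <= n)%N.
Hypothesis anchor_onto : forall x u, exists a, anchor A x a = u.
Hypothesis w_inj : forall x, injective (w x).
Hypothesis rE : r = (#|pairs n| + d)%N.
Implicit Types (x y : S) (m p : 'rV[R]_n).

(** Where no common zero exists this is the default 0, so the facts about [dev] are first stated at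
    good points. *)
Definition dev x : 'rV[R]_n := xget 0 [set m | fixes w x m].

Let good := lin_inj w.

Lemma dev_fixes x : good x -> fixes w x (dev x).
Proof.
move=> g; have [m mP] := lin_inj_fixes n2 anchor_onto rE g.
by rewrite /dev; case: xgetP => // h; case: (h m).
Qed.

Lemma good_open : open good.
Proof. exact: lin_inj_open. Qed.

(* The equation [w (Y i) f = 0], taken in the component s i for suitable
   sections Y i of the isotropy, is a linear system for f with invertible
   matrix. *)
Lemma dev_smooth : smooth_on good dev.
Proof.
apply: smooth_on_cover => x g.
have /choice[s sP] := other n2.
have /choice[Y YP] : forall i, exists Y : forall x, A x,
    [/\ smooth_section Y, forall y, anchor A y (Y y) = 0 & lin (w x (Y x)) = rot R i
      (s i)].
  move=> i; have [a [a0 aB]] := lin_onto anchor_onto rE g (rot_skew R i (s i)).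
  have [Y [sY Y0 Ya]] := kernel_section anchor_onto a0.
  by exists Y; split=> //; rewrite Ya.
have sY i : smooth_section (Y i) by have [] := YP i.
pose C y : 'M[R]_n := \matrix_(l, i) lin (w y (Y i y)) l (s i).
pose b y : 'rV[R]_n := \row_i - w y (Y i y) 0 0 (s i).
have sC i j : smooth_on setT (fun y => C y i j).
  apply: smooth_on_ext (lin_smooth w i (s j) (sY j)); first exact: openT.
  by move=> y _; rewrite [RHS]mxE.
have sb i : smooth_on setT (fun y => b y 0 i).
  apply: (smooth_on_ext (F := fun y => - w y (Y i y) 0 0 (s i))); first exact: openT.
    by move=> y _; rewrite mxE.
  by apply: smooth_on_opp; [exact: openT | exact: w_smooth].
have sdet : smooth_on setT (fun y => \det (C y)).
  by apply: smooth_on_det => //; exact: openT.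
pose V := [set y | good y /\ \det (C y) != 0].
have oV : open V.
  rewrite openE => y [gy Cy]; rewrite /interior; near=> z; split.
    by near: z; apply: open_nbhs_nbhs; split => //; exact: good_open.
  by near: z; exact: near_neq0 sdet Cy.
(* Column [s i] of [rot i (s i)] is the unit vector at [i]: the component chosen for [Y i] isolates
   coordinate [i] of the zero. *)
have C1 : C x = 1%:M.
  apply/matrixP => l i; rewrite [LHS]mxE; have [_ _ ->] := YP i.
  by rewrite !mxE eqxx andbT (negbTE (sP i)) andbF subr0.
exists V; split; first by split => //; rewrite C1 det1 oner_neq0.
apply/smooth_on_rV => // j.
apply: (smooth_on_ext (F := fun y => (\det (C y))^-1 * \sum_i b y 0 i * cofactor (C
  y) j i)) => //.
  move=> y [gy Cy]; have E : dev y *m C y = b y.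
    apply/rowP => i; have [_ Y0 _] := YP i.
    have := congr1 (fun v : 'rV[R]_n => v 0 (s i)) (dev_fixes gy (Y0 y)).
    rewrite wE [LHS]mxE [RHS]mxE => /eqP; rewrite addr_eq0 => /eqP h.
    by rewrite [RHS]mxE -h [LHS]mxE [RHS]mxE; apply: eq_bigr => l _; rewrite [C y _ _]mxE.
  have : dev y *m C y *m \adj (C y) = b y *m \adj (C y) by rewrite E.
  rewrite -mulmxA mul_mx_adj mul_mx_scalar => h.
  have -> : \sum_i b y 0 i * cofactor (C y) j i = \det (C y) * dev y 0 j.
    transitivity ((\det (C y) *: dev y) 0 j); last by rewrite mxE.
    by rewrite h mxE; apply: eq_bigr => i _; rewrite [\adj _ _ _]mxE.
  by rewrite mulKf.
have VT : V `<=` setT by [].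
apply: smooth_on_mul => //.
  apply: smooth_on_inv => //; first by move=> y [].
  exact: smooth_on_sub sdet.
apply: smooth_on_sum => // i _; apply: smooth_on_mul => //;
  first exact: smooth_on_sub (sb i).
by apply: smooth_on_cofactor => // k l; exact: smooth_on_sub (sC k l).
Unshelve. all: by end_near. Qed.

Lemma dev_tdiff x : good x -> tdiff x dev.
Proof. by move=> g; exact: smooth_on_tdiff dev_smooth g. Qed.

(* Differentiate [w Y dev = 0] for sections Y of the isotropy, and compare with
   [w [X, Y] dev = 0]. *)
Lemma dev_tder x (a : A x) : good x -> tder x (anchor A x a) dev = w x a (dev x).
Proof.
move=> g; apply/eqP; rewrite -subr_eq0; apply/eqP; apply: (skew_cancel n2) => B sB.
have [b [b0 bB]] := lin_onto anchor_onto rE g sB.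
have [Y [sY Y0 Yb]] := kernel_section anchor_onto b0.
have [X [sX Xa]] := section_through a.
have dd := dev_tdiff g; set u := anchor A x a; set m := dev x.
have kXY : w x (bracket X Y x) m = 0.
  by apply: (dev_fixes g); apply: anchor_bracket_ker => //; exact: r_gt0 rE.
have wY0 : w x (Y x) m = 0 by apply: (dev_fixes g).
have E1 : w x (bracket X Y x) m = nabla x u (fun y => w y (Y y)) m
    - nabla x (anchor A x (Y x)) (fun y => w y (X y)) m
    + vf_bracket (w x (X x)) (w x (Y x)) m.
  rewrite /u -Xa; exact: (f_equal (fun F : vfield R n => F m) (mor_bracket w sX sY x)).
(* What is left of [E1] is that [w x a m *m B] cancels the derivative of [w y (Y y)] evaluated at
   the fixed point [m]. *)
rewrite kXY Y0 /nabla tder0 subr0 vf_bracketE wY0 mul0mx subr0 Xa Yb bB in E1.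
have tl i j : tdiff x (fun y => lin (w y (Y y)) i j).
  exact: smooth_on_tdiff (lin_smooth w i j sY) (I : setT x).
have tw p j : tdiff x (fun y => w y (Y y) p 0 j).
  exact: smooth_on_tdiff (w_smooth w p j sY) (I : setT x).
have twp p : tdiff x (fun y => w y (Y y) p) by apply: differentiable_rV => j; exact: tw.
apply/rowP => j.
have Ed : tder x u (fun y => \sum_i dev y 0 i * lin (w y (Y y)) i j + w y (Y y) 0 0
  j) = 0.
  transitivity (tder x u (fun=> 0 : R)); last exact: tder_cst.
  apply: tder_near; near=> y.
  have gy : good y by near: y; apply: open_nbhs_nbhs; split => //; exact: good_open.
  have := congr1 (fun v : 'rV[R]_n => v 0 j) (dev_fixes gy (Y0 y)).
  by rewrite wE [LHS]mxE [RHS]mxE => h; rewrite -[RHS]h [X in _ = X + _]mxE.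
have Ew : tder x u (fun y => \sum_i m 0 i * lin (w y (Y y)) i j + w y (Y y) 0 0 j)
    = tder x u (fun y => w y (Y y) m) 0 j.
  rewrite tder_rV //; apply: tder_near; near=> y.
  by rewrite (wE w (Y y) m) [RHS]mxE [X in _ = X + _]mxE.
have di i : tdiff x (fun y => dev y 0 i) by exact: tdiff_rV.
have E2 : \sum_i tder x u (fun y => dev y 0 i) * B i j + tder x u (fun y =>
  w y (Y y) m) 0 j = 0.
  rewrite -[RHS]Ed -Ew !tder_add //; try by apply: tdiff_sum => i;
    apply: tdiff_mul => //; exact: tdiff_cst.
  rewrite !tder_sumr; try by move=> ?; apply: tdiff_mul => //; exact: tdiff_cst.
  rewrite addrA -big_split /=; congr (_ + _); apply: eq_bigr => i _.
  rewrite !tder_mul //; last exact: tdiff_cst.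
  by rewrite tder_cst mulr0 addr0 Yb bB -/m addrC [B i j * _]mulrC.
rewrite [RHS]mxE mulmxBl mxE [X in _ + X]mxE [X in X - _]mxE.
have := congr1 (fun v : 'rV[R]_n => v 0 j) E1; rewrite [LHS]mxE [RHS]mxE => /esym/eqP.
rewrite addrC addr_eq0 => /eqP ->; rewrite opprK -[RHS]E2; congr (_ + _).
by apply: eq_bigr => i _; rewrite tder_rV.
Unshelve. all: by end_near. Qed.

End Development.

Lemma dot_skew (R : realType) n (u : 'rV[R]_n) (B : 'M[R]_n) :
  B^T = - B -> dot u (u *m B) = 0.
Proof.
move=> sB; have : dot u (u *m B) = - dot (u *m B) u.
  by rewrite !dotE trmx_mul sB mulNmx mulmxN mulmxA mxE.
by rewrite [dot (_ *m _) _]dotC => h; lra.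
Qed.

(** * Closedness of the set of good points *)

Section Closed.
Variables (R : realType) (n d : nat) (S : manifold R d) (r : nat).
Variables (A : lieAlgebroid S r) (w : g_morphism n A).
Hypothesis n2 : (2 <= n)%N.
Hypothesis anchor_onto : forall x u, exists a, anchor A x a = u.
Hypothesis w_inj : forall x, injective (w x).
Hypothesis rE : r = (#|pairs n| + d)%N.
Implicit Types (x y : S) (m p : 'rV[R]_n).

Let good := lin_inj w.
Let f := dev w.

Lemma wZ y c a p j : w y (c *: a) p 0 j = c * w y a p 0 j.
Proof. by rewrite linearZ; exact: mxE. Qed.

Lemma w_sum y (I : Type) (s : seq I) (a : I -> A y) p j :
  w y (\sum_(i <- s) a i) p 0 j = \sum_(i <- s) w y (a i) p 0 j.
Proof. by rewrite linear_sum fct_sumE summxE. Qed.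

Lemma near_bounded U (F : S -> R) x : smooth_on U F -> U x ->
  \forall y \near x, `|F y| <= `|F x| + 1.
Proof.
move=> sF Ux; have cF := smooth_on_continuous sF Ux.
have /cvgrPdist_le/(_ 1 ltr01) h : F y @[y --> x] --> F x := cF.
near=> y; have : `|F x - F y| <= 1 by near: y.
move=> hy; rewrite -[F y](subrK (F x)) addrC (le_trans (ler_normD _ _)) //.
by rewrite lerD2l distrC.
Unshelve. all: by end_near. Qed.

(** The growth estimate needs lifts of a chart velocity whose translation parts are bounded
    uniformly up to the limit point, including at points not known to be good. Cramer's rule in a
    frame that is standard at [x0] gives them explicitly. *)
Lemma local_lift x0 : exists K, 0 <= K /\ \forall y \near x0,
  forall v, exists a, tder y (anchor A y a) (chart (m:=S) (chart_at x0)) = v /\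
    forall j, `|w y a 0 0 j| <= K * \sum_l `|v 0 l|.
Proof.
have [X [sX Xx]] := anchor_frame anchor_onto x0.
pose c := chart_at x0; have cx : cdom c x0 := cdom_at x0.
have oc : open (cdom c) := cdom_open c.
pose P y := \matrix_k anchor_comp (X k) c y.
have sP i j : smooth_on (cdom c) (fun y => P y i j).
  apply: (smooth_on_ext (F := fun y => anchor_comp (X i) c y 0 j)) => //.
    by move=> y _; rewrite mxE.
  exact: anchor_comp_smooth.
have P1 : P x0 = 1%:M.
  by apply/row_matrixP => k; rewrite rowK row1 /anchor_comp Xx tder_chart_self.
have sdet : smooth_on (cdom c) (fun y => \det (P y)) by exact: smooth_on_det.
pose h (lj : 'I_d * 'I_n) y := \sum_k cofactor (P y) k lj.1 * w y (X k y) 0 0 lj.2.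
have sh lj : smooth_on (cdom c) (h lj).
  apply: smooth_on_sum => // k _; apply: smooth_on_mul => //.
    exact: smooth_on_cofactor.
  by apply: smooth_on_sub (w_smooth w 0 lj.2 (sX k)).
pose K0 := \sum_lj (`|h lj x0| + 1).
have K0ge lj : `|h lj x0| + 1 <= K0.
  by rewrite /K0 (bigD1 lj) //= lerDl sumr_ge0 // => i _; rewrite addr_ge0.
(* Near [x0] the determinant is at least 1/2, whence the 2, and [K0] bounds every coefficient
   [h lj]. *)
exists (2 * K0); split.
  by rewrite mulr_ge0 // sumr_ge0 // => i _; rewrite addr_ge0.
have cdet : \forall y \near x0, 2^-1 <= \det (P y).
  have /cvgrPdist_le/(_ 2^-1) := smooth_on_continuous sdet cx.
  rewrite invr_gt0 ltr0n => /(_ isT); rewrite P1 det1; apply: filterS => y.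
  by rewrite ler_norml => /andP[_]; lra.
near=> y => v; have cy : cdom c y by near: y; exact: near_cdom.
have dy : 2^-1 <= \det (P y) by near: y.
have d0 : 0 < \det (P y) by apply: lt_le_trans dy; rewrite invr_gt0 ltr0n.
have dn0 : \det (P y) != 0 by rewrite gt_eqF.
have hy lj : `|h lj y| <= `|h lj x0| + 1.
  move: lj; near: y; apply: filter_forall => lj; exact: near_bounded (sh lj) cx.
exists ((\det (P y))^-1 *: \sum_k (v *m \adj (P y)) 0 k *: X k y); split.
  have dc := tdiff_chart cy.
  rewrite linearZ /= tderZ // linear_sum tder_sum //.
  under eq_bigr do rewrite linearZ /= tderZ //.
  have -> : \sum_i (v *m \adj (P y)) 0 i *: tder y (anchor A y (X i y)) (chart c)
     = v *m \adj (P y) *m P y.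
    by rewrite [RHS]mulmx_sum_row; apply: eq_bigr => k _; rewrite rowK.
  by rewrite -mulmxA mul_adj_mx mul_mx_scalar scalerA mulVf // scale1r.
move=> j.
have -> : w y ((\det (P y))^-1 *: \sum_k (v *m \adj (P y)) 0 k *: X k y) 0 0 j
    = (\det (P y))^-1 * \sum_l v 0 l * h (l, j) y.
  rewrite wZ w_sum; congr (_ * _).
  transitivity (\sum_k \sum_l v 0 l * (cofactor (P y) k l * w y (X k y) 0 0 j)).
    apply: eq_bigr => k _; rewrite wZ mxE mulr_suml.
    by apply: eq_bigr => l _; rewrite [(\adj _) _ _]mxE [RHS]mulrA.
  by rewrite exchange_big; apply: eq_bigr => l _; rewrite /h mulr_sumr.
rewrite normrM -mulrA ler_pM // ?normr_ge0 //.
  by rewrite gtr0_norm ?invr_gt0 // -[leRHS]invrK lef_pV2 // posrE invr_gt0 ltr0n.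
rewrite mulr_sumr; apply: le_trans (ler_norm_sum _ _ _) _.
apply: ler_sum => l _; rewrite normrM mulrC ler_wpM2r //.
exact: le_trans (hy _) (K0ge _).
Unshelve. all: by end_near. Qed.

Lemma dev_norm_smooth : smooth_on good (fun y => dot (f y) (f y)).
Proof.
have og := good_open w anchor_onto rE.
have /smooth_on_rV -/(_ og) sf := dev_smooth w n2 anchor_onto rE.
by apply: smooth_on_sum => // i _; exact: smooth_on_mul.
Qed.

Lemma tder_dev_norm y (a : A y) : good y ->
  tder y (anchor A y a) (fun y => dot (f y) (f y)) = 2 * dot (f y) (w y a 0).
Proof.
move=> gy; have df := dev_tdiff n2 anchor_onto rE gy.
rewrite tder_dot // dev_tder // -/f (wE w a (f y)) dotDr dot_skew ?add0r;
  last exact: w_skew.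
by lra.
Qed.

(* Along a segment in a chart, [1 + |f|^2] grows at most exponentially, since
   [f . w a f] only involves the translation part of [w a]. *)
Lemma dev_bound c (q v : 'rV[R]_d) (K s : R) : 0 <= K -> 0 < s ->
  let gam t := cinv (m:=S) c (t *: v + q) in
  (forall t, 0 <= t < s -> [/\ cdom c (gam t), chart c (gam t) = t *: v + q,
     good (gam t) & exists a : A (gam t),
       tder (gam t) (anchor A (gam t) a) (chart (m:=S) c) = v /\
       forall j, `|w (gam t) a 0 0 j| <= K]) ->
  exists M, forall t, 0 <= t < s -> dot (f (gam t)) (f (gam t)) <= M.
Proof.
move=> K0 s0 gam h.
(* The bounds [2 u b <= K (1 + u^2)] for the [n] components add up to [K (n + N)], which is at most
   [L (1 + N)]. *)
pose N y := dot (f y) (f y); pose L := K * n.+1%:R.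
have L0 : 0 <= L by rewrite mulr_ge0.
pose line (t : R) : 'rV[R]_d := t *: v + q.
have dN t : 0 <= t < s -> is_derive t (1 : R) (N \o gam :
  R -> R) ('D_v (N \o cinv (m:=S) c) (line t))
    /\ 'D_v (N \o cinv (m:=S) c) (line t) <= L * (1 + N (gam t)).
  move=> ts; have [ct cE' gt [a [av aK]]] := h t ts.
  have cE : chart c (gam t) = line t := cE'.
  have dNc : differentiable (N \o cinv (m:=S) c) (line t).
    by rewrite -cE; exact: smooth_on_differentiable dev_norm_smooth gt ct.
  split; first exact: is_derive_along dNc.
  have -> : 'D_v (N \o cinv (m:=S) c) (line t) = tder (gam t) (anchor A (gam t) a) N.
    by rewrite (tder_chart _ ct) cE ?av.
  rewrite tder_dev_norm //.
  have : \sum_j (1 + f (gam t) 0 j * f (gam t) 0 j) * K <= L * (1 + N (gam t)).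
    rewrite -mulr_suml big_split /= sumr_const card_ord -/(dot _ _) -/(N _) mulrC /L
      -mulrA ler_wpM2l //.
    rewrite mulrDr mulr1; have : 0 <= N (gam t) := dot_ge0 _.
    have : (n%:R : R) + 1 = n.+1%:R by rewrite -natr1.
    have : 0 <= (n%:R : R) by [].
    by move: (n%:R : R) (n.+1%:R : R) (N _) => a1 a2 a3 h1 <- h3; nra.
  apply: le_trans; rewrite /dot mulr_sumr; apply: ler_sum => j _.
  have := aK j; rewrite ler_norml => /andP[]; move: (f _ 0 j) (w (gam t) a 0 0 j) => u b.
  (* The two nonnegative products add up to [2 K (1 + u^2) - 4 u b]. *)
  move=> b1 b2; have h1 : 0 <= (K - b) * (1 + u) ^+ 2 by rewrite mulr_ge0 ?sqr_ge0 //
    subr_ge0.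
  have h2 : 0 <= (K + b) * (1 - u) ^+ 2 by rewrite mulr_ge0 ?sqr_ge0 // addrC
    -lerBlDr sub0r.
  by lra.
(* Integrating factor: the differential inequality [N' <= L (1 + N)] makes [H] nonincreasing.
   Replacing [t] by [s] in the exponential gives a bound valid on the whole half-open interval. *)
pose H t := (1 + N (gam t)) * expR (- L * t).
have dH t : 0 <= t < s -> is_derive t (1 : R) H
    (('D_v (N \o cinv (m:=S) c) (line t) - L * (1 + N (gam t))) * expR (- L * t)).
  move=> ts; have [dNt _] := dN t ts.
  have d1 : is_derive t (1 : R) (fun t => 1 + N (gam t)) ('D_v (N \o cinv (m:=S) c)
    (line t)).
    by apply: is_derive_eq (is_deriveD (is_derive_cst (1 : R) t 1) dNt) _; rewrite add0r.
  have d2 : is_derive t (1 : R) (fun t => expR (- L * t)) (expR (- L * t) * (- L)).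
    apply: (is_derive1_comp (f := expR) (g := fun t => - L * t)).
    by apply: is_derive_eq; rewrite /GRing.scale /= mulr1.
  by apply: is_derive_eq (is_deriveM d1 d2) _; rewrite /GRing.scale /=; ring.
exists ((1 + N (gam 0)) * expR (L * s)) => t ts; have /andP[t0 ts'] := ts.
have H0t : H t <= H 0.
  have sub u : 0 <= u <= t -> 0 <= u < s.
    by move=> /andP[-> ut]; rewrite (le_lt_trans ut).
  apply: (@ler0_derive1_nincr _ H 0 t) => //.
  - move=> u; rewrite in_itv /= => /andP[u0 ut].
    by apply: (ex_derive (is_derive := dH u _)); rewrite sub // !ltW.
  - move=> u; rewrite in_itv /= => /andP[u0 ut];
    have us : 0 <= u < s by rewrite sub // !ltW.
    rewrite derive1E (derive_val (is_derive := dH u us)).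
    by rewrite mulr_le0_ge0 ?expR_ge0 // subr_le0; have [] := dN u us.
  - apply: derivable_within_continuous => u; rewrite in_itv /= => ut.
    exact: (ex_derive (is_derive := dH u (sub _ ut))).
rewrite /H mulr0 expR0 mulr1 mulNr expRN in H0t.
have e0 : 0 < expR (L * t) by exact: expR_gt0.
rewrite ler_pdivrMr // in H0t.
apply: (@le_trans _ _ (1 + N (gam t))); first by rewrite lerDr.
have t1 : expR (L * t) <= expR (L * s) by rewrite ler_expR ler_wpM2l // ltW.
apply: le_trans H0t _; apply: ler_wpM2l => //.
by apply: addr_ge0 => //; exact: dot_ge0.
Qed.

(** If [x0] were bad, follow the chart segment from [z] to [x0] up to the first bad time [s]. Before
    [s], [dev] is bounded; at [s], the isotropy contains a nonzero translation. Extend it to a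
    section [Y] of [ker #]: just before [s] a bounded [f] cannot solve [f *m lin (w Y) + w Y 0 = 0],
    since the linear part is small and the translation part is not. *)
Lemma good_limit x0 : \forall z \near x0, good z -> good x0.
Proof.
pose c := chart_at x0; have cx : cdom c x0 := cdom_at x0; pose p0 := chart c x0.
have [K [K0 hK]] := local_lift x0.
have [e /= e0 eN] : nbhs_ball p0 (fun q : 'rV[R]_d => [/\ cdom c (cinv (m:=S) c q),
    chart c (cinv (m:=S) c q) = q & forall v, exists a : A (cinv (m:=S) c q),
      tder (cinv (m:=S) c q) (anchor A (cinv (m:=S) c q) a) (chart (m:=S) c) = v /\
      forall j, `|w (cinv (m:=S) c q) a 0 0 j| <= K * \sum_l `|v 0 l|]).
  apply/nbhs_ballP; near=> q.
  have [h1 h2] : cdom c (cinv (m:=S) c q) /\ chart c (cinv (m:=S) c q) = q.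
    by near: q; exact: near_cimg.
  by split => //; near: q; exact: (near_cinv cx hK).
near=> z; have cz : cdom c z by near: z; exact: near_cdom.
have bq : ball p0 e (chart c z) by near: z;
  apply: (@near_chart _ _ S c x0 (ball p0 e)) => //; exact: nbhsx_ballx.
set q := chart c z in bq *; move=> gz; apply: contrapT => ngx.
pose v := p0 - q; pose gam (t : R) := cinv (m:=S) c (t *: v + q).
have bl t : 0 <= t <= 1 -> ball p0 e (t *: v + q).
  move=> /andP[t0 t1]; rewrite -ball_normE /=.
  have -> : p0 - (t *: v + q) = (1 - t) *:
    v by rewrite scalerBl scale1r opprD addrCA addrC.
  rewrite normrZ ger0_norm ?subr_ge0 //; move: bq; rewrite -ball_normE /= -/v.
  apply: le_lt_trans; rewrite -[leRHS]mul1r ler_wpM2r //; lra.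
have gamN t : 0 <= t <= 1 -> cdom c (gam t) /\ chart c (gam t) = t *: v + q.
  by move=> /bl/eN[].
have near_gam t (P : set S) : 0 <= t <= 1 -> (\forall y \near gam t, P y) ->
    \forall t' \near t, P (gam t').
  move=> t01 Py; have [ct cE] := gamN t t01.
  have := near_cinv ct Py; rewrite cE => Pq.
  exact: (differentiable_continuous (differentiable_line v q t)) _ Pq.
have gam0 : gam 0 = z by rewrite /gam scale0r add0r /q chartK.
have gam1 : gam 1 = x0 by rewrite /gam scale1r /v subrK /p0 chartK.
pose E := [set t : R | 0 <= t <= 1 /\ ~ good (gam t)].
have E1 : E 1 by split; [rewrite ler01 lexx | rewrite gam1].
have lbE : lbound E 0 by move=> t [/andP[]].
have hlE : has_lbound E by exists 0.
have hiE : has_inf E by split => //; exists 1.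
pose s := inf E.
have s0 : 0 <= s by apply: lb_le_inf => //; exists 1.
have s1 : s <= 1 by apply: ge_inf.
have s01 : 0 <= s <= 1 by rewrite s0.
have lts t : 0 <= t < s -> good (gam t).
  move=> /andP[t0 ts]; apply: contrapT => ng.
  have : s <= t by apply: ge_inf => //; split=> //; rewrite t0 (le_trans (ltW ts)).
  by rewrite leNgt ts.
(* Goodness is open, so the infimum of the bad times is itself a bad time. *)
have ngs : ~ good (gam s).
  move=> gs; have : \forall y \near gam s, good y.
    by apply: open_nbhs_nbhs; split => //; exact: good_open.
  move=> /(near_gam s _ s01) /nbhs_ballP[/= del del0 hd].
  have [t Et tlt] := inf_adherent del0 hiE.
  apply: Et.2; apply: hd; rewrite -ball_normE /= distrC ger0_norm.
    by rewrite ltrBlDl.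
  by rewrite subr_ge0; exact: (ge_inf hlE Et).
have s_gt0 : 0 < s.
  by rewrite lt_neqAle s0 andbT; apply/eqP => s00; apply: ngs; rewrite -s00 gam0.
have [M hM] : exists M, forall t, 0 <= t < s -> dot (f (gam t)) (f (gam t)) <= M.
  apply: (@dev_bound c q v (K * \sum_l `|v 0 l|)) => //.
    by apply: mulr_ge0 => //; apply: sumr_ge0.
  move=> t ts; have t01 : 0 <= t <= 1.
    by move: ts => /andP[-> ts]; rewrite ltW // (lt_le_trans ts).
  by have [h1 h2 h3] := eN _ (bl t t01); split => //; exact: lts.
have [a [a0 la an0]] : exists a, [/\ anchor A (gam s) a = 0,
  lin (w (gam s) a) = 0 & a <> 0].
  apply: contrapT => h; apply: ngs => a a0 la; apply: contrapT => an0.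
  by apply: h; exists a.
have [j bj] : exists j, w (gam s) a 0 0 j != 0.
  apply: contrapT => h; apply: an0; apply: (w_eq0 w_inj); apply/funext => p.
  rewrite wE la mulmx0 add0r; apply/rowP => j; rewrite [RHS]mxE; apply/eqP.
  by apply/negPn/negP => hj; apply: h; exists j.
have [Y [sY Y0 Ya]] := kernel_section anchor_onto a0.
(* [Phi] is positive at the first bad time, where the linear part vanishes. At earlier times
   [w (Y y) f = 0] and [|f_i| <= 1 + M], a consequence of [f_i^2 <= M], make it nonpositive. *)
pose Phi y := `|w y (Y y) 0 0 j| - (1 + M) * \sum_i `|lin (w y (Y y)) i j|.
have cPhi : {for gam s, continuous Phi}.
  apply: cvgB; first by apply: cvg_norm; apply:
    (smooth_on_continuous (w_smooth w 0 j sY) I).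
  apply: cvgM; first exact: cvg_cst.
  apply: cvg_big; first exact: add_continuous.
  move=> i _.
  by apply: cvg_norm; apply: (smooth_on_continuous (lin_smooth w i j sY) I).
have Phi_s : 0 < Phi (gam s).
  rewrite /Phi Ya la big1 ?mulr0 ?subr0 ?normr_gt0 // => i _.
  by rewrite mxE normr0.
have : \forall y \near gam s, 0 < Phi y by apply: (cPhi [set u : R | 0 < u]);
  exact: lt_nbhsr.
move=> /(near_gam s _ s01) /nbhs_ballP[/= del del0 hd].
pose t := Num.max 0 (s - del / 2).
have t0 : 0 <= t by rewrite le_max lexx.
have ts : t < s by rewrite gt_max s_gt0 /= ltrBlDr ltrDl divr_gt0.
have tss : 0 <= t < s by rewrite t0.
have : 0 < Phi (gam t).
  apply: hd; rewrite -ball_normE /= ger0_norm ?subr_ge0 ?ltW // ltrBlDl -ltrBlDr.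
  by rewrite lt_max; apply/orP; right; rewrite ltrD2l ltrN2 ltr_pdivrMr // mulr_natr
    mulr2n ltrDl.
have := dev_fixes n2 anchor_onto rE (lts t tss) (Y0 (gam t)).
move=> /(congr1 (fun u : 'rV[R]_n => u 0 j)); rewrite wE [LHS]mxE [RHS]mxE => /eqP.
rewrite addrC addr_eq0 => /eqP hw; rewrite /Phi hw normrN subr_gt0 ltNge => /negP; apply.
rewrite [X in `|X|]mxE mulr_sumr; apply: le_trans (ler_norm_sum _ _ _) _.
apply: ler_sum => i _; rewrite normrM ler_wpM2r //.
have : f (gam t) 0 i * f (gam t) 0 i <= M.
  apply: le_trans (hM t tss); rewrite /dot (bigD1 i) //= lerDl.
  by apply: sumr_ge0 => k _; rewrite -expr2 sqr_ge0.
rewrite -/f; move: (f (gam t) 0 i) => u uM.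
have := sqr_ge0 (1 - u); have := sqr_ge0 (1 + u); rewrite ler_norml => h1 h2.
by apply/andP; split; nra.
Unshelve. all: by end_near. Qed.

(** On the connected image of a path from [x0] to [x], the good points form a nonempty, open and
    closed subset. *)
Lemma good_all x0 m0 : simply_connected R S -> fixes w x0 m0 -> forall x, good x.
Proof.
move=> [_ pc _] fx x; have [g [cg g0 g1]] := pc x0 x.
have I0 : `[0, 1]%classic (0 : R) by rewrite /= in_itv /= lexx ler01.
have I1 : `[0, 1]%classic (1 : R) by rewrite /= in_itv /= lexx ler01.
have cI : connected (g @` `[0, 1]%classic).
  by apply: connected_continuous_connected => //; exact: segment_connected.
suff : g @` `[0, 1]%classic `&` good = g @` `[0, 1]%classic.
  by move=> h; have [] : (g @` `[0, 1]%classic `&` good) x by rewrite h; exists 1.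
have og := good_open w anchor_onto rE.
apply: cI.
- by exists x0; split; [exists 0 | exact: fixes_lin_inj fx].
- by exists good.
- exists good => //; rewrite closedE => y ny; apply: contrapT => ngy.
  by apply: ny; apply: filterS (good_limit y) => z hz gz; apply: ngy; exact: hz.
Qed.

End Closed.

(** * Normals and fundamental forms *)

Section NormalVector.
Variables (R : realType) (d : nat).
Implicit Types (M : 'M[R]_(d, d.+1)) (b : 'rV[R]_d.+1).

Lemma widen_lift_max (k : 'I_d) : widen_ord (leqnSn d) k = lift ord_max k.
Proof. by apply: val_inj; rewrite /= /bump leqNgt ltn_ord. Qed.

Lemma extend_lift (T : Type) (v : 'I_d -> T) (t : T) k :
  @extend d.+1 d T v t (lift ord_max k) = v k.
Proof.
rewrite -widen_lift_max /extend /=; case: insubP => [k' _ /val_inj -> //|].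
by rewrite ltn_ord.
Qed.

Lemma extend_max (T : Type) (v : 'I_d -> T) (t : T) : @extend d.+1 d T v t ord_max = t.
Proof. by rewrite /extend insubF //= ltnn. Qed.

Lemma extend_comp (T U : Type) (h : T -> U) (v : 'I_d -> T) (t : T) i :
  h (@extend d.+1 d T v t i) = extend (h \o v) (h t) i.
Proof. by rewrite /extend; case: insub. Qed.

Definition add_row M b : 'M[R]_d.+1 := \matrix_i extend (fun k => row k M) b i.

(** The cross product of the rows of [M]. Cofactors along the last row ignore that row, so the
    appended 0 is only a filler. *)
Definition normal M : 'rV[R]_d.+1 := \row_j cofactor (add_row M 0) ord_max j.

Lemma row_add_row_lift M b k : row (lift ord_max k) (add_row M b) = row k M.
Proof. by rewrite rowK extend_lift. Qed.

Lemma row_add_row_max M b : row ord_max (add_row M b) = b.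
Proof. by rewrite rowK extend_max. Qed.

Lemma add_row_lift M b k j : add_row M b (lift ord_max k) j = M k j.
Proof. by rewrite mxE extend_lift mxE. Qed.

Lemma add_row_max M b j : add_row M b ord_max j = b 0 j.
Proof. by rewrite mxE extend_max. Qed.

Lemma det_add_row M b : \det (add_row M b) = dot (normal M) b.
Proof.
rewrite (expand_det_row _ ord_max) /dot; apply: eq_bigr => j _.
rewrite mulrC add_row_max [normal M 0 j]mxE; congr (_ * _).
rewrite /cofactor; congr (_ * \det _); apply/matrixP => k l.
by rewrite 2![LHS]mxE 2![RHS]mxE !add_row_lift.
Qed.

Lemma normal_orth M k : dot (normal M) (row k M) = 0.
Proof.
rewrite -det_add_row; apply: (determinant_alternate (i1 := lift ord_max k) (i2 :=
  ord_max)).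
  by rewrite eq_sym neq_lift.
by move=> j; rewrite add_row_lift add_row_max mxE.
Qed.

Lemma mul_add_row (u : 'rV[R]_d.+1) M b :
  u *m add_row M b = (\row_k u 0 (lift ord_max k)) *m M + u 0 ord_max *: b.
Proof.
rewrite [LHS]mulmx_sum_row big_ord_recr /= row_add_row_max; congr (_ + _).
rewrite [RHS]mulmx_sum_row; apply: eq_bigr => k _.
by rewrite widen_lift_max row_add_row_lift mxE.
Qed.

Lemma row_lift_eq0 (u : 'rV[R]_d.+1) :
  \row_k u 0 (lift ord_max k) = 0 -> u 0 ord_max = 0 -> u = 0.
Proof.
move=> h1 h2; apply/rowP => i; rewrite mxE; case: (unliftP ord_max i) => [k ->|-> //].
by have := congr1 (fun v : 'rV[R]_d => v 0 k) h1; rewrite !mxE.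
Qed.

(** If the normal vanished, appending any row [b] to [M] would give determinant 0, so every [b]
    would lie in the span of only [d] rows. *)
Lemma normal_neq0 M : row_free M -> normal M != 0.
Proof.
move=> fM; apply/eqP => N0.
suff : (1%:M <= M)%MS.
  by move=> /mxrankS; rewrite mxrank1; move: fM; rewrite /row_free => /eqP ->;
    rewrite ltnn.
apply/row_subP => i; set b := row i _.
have /eqP/det0P[u u0] : \det (add_row M b) = 0 by rewrite det_add_row N0 dot0l.
rewrite mul_add_row; set u' := \row_k _ => uM.
have t0 : u 0 ord_max != 0.
  apply/eqP => t0; move: uM u0; rewrite t0 scale0r addr0 => u'M.
  rewrite (row_lift_eq0 _ t0) ?eqxx //; apply/(row_free_inj fM).
  by rewrite -/u' u'M mul0mx.
have -> : b = (- (u 0 ord_max)^-1 *: u') *m M.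
  move/eqP: uM; rewrite addr_eq0 => /eqP uM.
  by rewrite -scalemxAl uM scalerN scaleNr opprK scalerA mulVf // scale1r.
exact: submxMl.
Qed.

Lemma add_row_normal_unit M : row_free M -> add_row M (normal M) \in unitmx.
Proof.
move=> fM; rewrite unitmxE unitfE det_add_row.
by apply: contra (normal_neq0 fM) => /eqP /dot_eq0 ->.
Qed.

(** The rows of [M] and the normal form a basis, in which the coefficient of [b] along the normal
    [N] is [dot b N / dot N N]. *)
Lemma orth_normal M b : row_free M -> dot b (normal M) = 0 -> exists u, b = u *m M.
Proof.
move=> fM bN; have uM := add_row_normal_unit fM; set N := normal M in bN uM *.
have := mulmxKV uM b; rewrite mul_add_row; set t := _ 0 ord_max; set u := \row_k _ => bE.
exists u; rewrite -bE.
have : dot b N = t * dot N N.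
  rewrite -bE dotDl dotZl [X in X + _](_ : _ = 0) ?add0r // dotC dotE trmx_mul mulmxA.
  have -> : N *m M^T = 0.
    apply/rowP => k; rewrite [RHS]mxE -[RHS](normal_orth M k) mxE.
    by apply: eq_bigr => j _; rewrite [row _ _ _ _]mxE [M^T _ _]mxE.
  by rewrite mul0mx mxE.
rewrite bN => /esym/eqP; rewrite mulf_eq0 => /orP[/eqP ->|/eqP /dot_eq0 N0].
  by rewrite scale0r addr0.
by move: (normal_neq0 fM); rewrite (N0 : normal M = 0) eqxx.
Qed.

Lemma det_add_row_mul (J : 'M[R]_d) M b :
  \det (add_row (J *m M) b) = \det J * \det (add_row M b).
Proof.
(* The block diagonal matrix with blocks [J] and 1. *)
pose B : 'M[R]_d.+1 := \matrix_i extend (fun k =>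
  \row_j extend (fun l => J k l) 0 j) (delta_mx 0 ord_max) i.
have -> : add_row (J *m M) b = B *m add_row M b.
  apply/row_matrixP => i; rewrite row_mul mul_add_row.
  case: (unliftP ord_max i) => [k ->|->].
    rewrite row_add_row_lift row_mul rowK extend_lift mxE extend_max scale0r addr0.
    by congr (_ *m _); apply/rowP => l; rewrite !mxE extend_lift.
  rewrite row_add_row_max rowK extend_max mxE !eqxx scale1r.
  rewrite [X in X *m M](_ : _ = 0) ?mul0mx ?add0r //.
  by apply/rowP => l; rewrite !mxE eqxx eq_sym (negbTE (neq_lift _ _)).
rewrite det_mulmx; congr (_ * _); rewrite (expand_det_row _ ord_max).
rewrite (bigD1 ord_max) //= big1 ?addr0 => [|j jm]; last first.
  by rewrite mxE extend_max mxE (negbTE jm) andbF mul0r.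
rewrite mxE extend_max mxE !eqxx mul1r /cofactor /= addnn -signr_odd odd_double mul1r.
congr (\det _); apply/matrixP => k l.
by rewrite 3!mxE extend_lift mxE extend_lift.
Qed.

(** This is how the normal depends on the tangent frame: a change of chart affects its normalization
    only through the sign of the Jacobian. *)
Lemma normal_mul (J : 'M[R]_d) M : normal (J *m M) = \det J *: normal M.
Proof.
by apply: dot_ext => b; rewrite dotZl -!det_add_row det_add_row_mul.
Qed.

Lemma det_onto (s : R) : (0 < d)%N -> exists V : 'M[R]_d, \det V = s.
Proof.
move=> d0; pose i0 : 'I_d := Ordinal d0.
exists (diag_mx (\row_i if i == i0 then s else 1)).
rewrite det_diag (bigD1 i0) //= mxE eqxx big1 ?mulr1 // => i /negbTE ii.
by rewrite mxE ii.
Qed.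

(** Here [s] is the orientation sign. Orthogonality leaves a multiple of the normal, unit length
    leaves two candidates, and one positively oriented frame picks the sign. The closed formula
    gives existence and uniqueness, and later differentiability. *)
Lemma unit_normalE (s : R) M b : (0 < d)%N -> row_free M -> s * s = 1 ->
  [/\ forall u : 'rV[R]_d, dot b (u *m M) = 0, dot b b = 1
    & forall V : 'M[R]_d, 0 < s * \det V -> 0 < \det (add_row (V *m M) b)] <->
  b = (s / Num.sqrt (dot (normal M) (normal M))) *: normal M.
Proof.
move=> d0 fM ss; set N := normal M; set q := Num.sqrt _.
have NN0 : 0 < dot N N.
  rewrite lt_neqAle dot_ge0 andbT eq_sym.
  by apply: contra (normal_neq0 fM) => /eqP /dot_eq0 N0; apply/eqP.
have q0 : 0 < q by rewrite sqrtr_gt0.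
have qq : q * q = dot N N by rewrite -expr2 sqr_sqrtr ?ltW.
have s0 : s != 0 by apply/eqP => s0; move: ss; rewrite s0 mul0r => /eqP;
  rewrite eq_sym oner_eq0.
have Northo (u : 'rV[R]_d) : dot N (u *m M) = 0.
  rewrite dotC dotE -mulmxA; suff -> : M *m N^T = 0 by rewrite mulmx0 mxE.
  apply/colP => k; rewrite [RHS]mxE -[RHS](normal_orth M k) dotC mxE.
  by apply: eq_bigr => j _; rewrite [row _ _ _ _]mxE [N^T _ _]mxE.
split=> [[b1 b2 b3]|->]; last first.
  split=> [u||V sV].
  - by rewrite dotZl Northo mulr0.
  - rewrite dotZl dotZr -qq; move: (lt0r_neq0 q0) => qn0.
    by rewrite mulrA (_ : s / q * (s / q) * (q * q) = s * s) //; field.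
  rewrite det_add_row_mul det_add_row dotZr -/N -qq.
  have -> : \det V * (s / q * (q * q)) = s * \det V * q.
    by rewrite (mulrA (s / q)) divfK ?lt0r_neq0 // mulrA [\det V * s]mulrC.
  exact: mulr_gt0 sV q0.
pose lam := dot b N / dot N N.
have bE : b = lam *: N.
  apply/eqP; rewrite -subr_eq0; apply/eqP.
  have [u uE] : exists u, b - lam *: N = u *m M.
    apply: orth_normal => //; rewrite dotBl dotZl /lam mulfVK ?subrr //.
    by rewrite gt_eqF.
  apply: dot_eq0; rewrite {2}uE dotBl dotZl b1 Northo mulr0 subrr //.
(* A test frame of determinant [s] is positively oriented because [s * s = 1]. *)
have [V dV] := det_onto s d0.
have := b3 V; rewrite dV ss ltr01 => /(_ isT);
  rewrite det_add_row_mul dV det_add_row bE dotZr -qq -/N => pos.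
have l2 : (s * lam * q) ^+ 2 = 1.
  move: b2; rewrite bE dotZl dotZr -qq => <-; rewrite -[RHS]mul1r -ss; ring.
have pos' : 0 < s * lam * q.
  by move: pos; rewrite (_ : s * (lam * (q * q)) = s * lam * q * q);
    [rewrite pmulr_lgt0 | ring].
have h1 : s * lam * q = 1.
  by apply/eqP; rewrite -(@eqrXn2 _ 2) ?ler01 ?ltW // l2 expr1n.
congr (_ *: _); apply: (mulfI s0); rewrite [RHS]mulrA ss mul1r.
by apply: (mulIf (lt0r_neq0 q0)); rewrite h1 mulVf // gt_eqF.
Qed.

End NormalVector.

Section UnitNormal.
Variables (R : realType) (d : nat) (S : manifold R d) (o : orientation S).
Variable f : S -> 'rV[R]_d.+1.
Hypothesis f_imm : immersion f.
Hypothesis d0 : (0 < d)%N.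
Implicit Types x y : S.

Definition jac x : 'M[R]_(d, d.+1) := \matrix_k tder x (delta_mx 0 k) f.

Lemma imm_tdiff x : tdiff x f.
Proof. exact: smooth_on_tdiff f_imm.1 (I : setT x). Qed.

Lemma tder_jac x u : tder x u f = u *m jac x.
Proof.
rewrite {1}[u]row_sum_delta tder_sum ?[RHS]mulmx_sum_row; last exact: imm_tdiff.
by apply: eq_bigr => k _; rewrite tderZ ?rowK //; exact: imm_tdiff.
Qed.

Lemma jac_free x : row_free (jac x).
Proof. by apply/inj_row_free => u; rewrite -tder_jac; exact: f_imm.2. Qed.

Let sgn x : R := (-1) ^+ osgn o x.

Lemma sgn2 x : sgn x * sgn x = 1.
Proof. by rewrite -expr2 sqrr_sign. Qed.

Let nu x := (sgn x / Num.sqrt (dot (normal (jac x)) (normal (jac x)))) *: normal (jac x).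

Lemma is_unit_normalE x b : is_unit_normal o f x b <-> b = nu x.
Proof.
rewrite -(unit_normalE b d0 (jac_free x) (sgn2 x)).
have E V : \matrix_(i < d.+1) extend (fun k =>
  tder x (row k V) f) b i = add_row (V *m jac x) b.
  apply/row_matrixP => i; rewrite !rowK; congr (extend _ _ _).
  by apply/funext => k; rewrite tder_jac row_mul.
have rV (v : 'I_d -> 'rV[R]_d) : v = fun k => row k (\matrix_k v k).
  by apply/funext => k; rewrite rowK.
split=> -[h1 h2 h3]; split=> //.
- by move=> u; rewrite -tder_jac.
- move=> V sV; have := h3 (fun k => row k V); rewrite E; apply.
  rewrite /pos_basis; suff -> : \matrix_k row k V = V by [].
  by apply/row_matrixP => k; rewrite rowK.
- by move=> u; rewrite tder_jac.
- by move=> v pv; rewrite (rV v) E; apply: h3.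
Qed.

Lemma unit_normal_eq x : unit_normal o f x = nu x.
Proof.
by apply: xget_unique => [|b]; [exact/is_unit_normalE | move=> /is_unit_normalE].
Qed.

Lemma unit_normalP x : is_unit_normal o f x (unit_normal o f x).
Proof. by apply/is_unit_normalE; exact: unit_normal_eq. Qed.

Lemma orth_unit_normal x b : dot b (unit_normal o f x) = 0 -> exists u, tder x u f = b.
Proof.
rewrite unit_normal_eq /nu dotZr => /eqP; rewrite mulf_eq0 => /orP[|/eqP h].
  rewrite mulf_eq0 signr_eq0 invr_eq0 /= sqrtr_eq0 => le0.
  have := normal_neq0 (jac_free x); have /dot_eq0 -> :
    dot (normal (jac x)) (normal (jac x)) = 0.
    by apply/eqP; rewrite eq_le le0 dot_ge0.
  by rewrite eqxx.
by have [u ->] := orth_normal (jac_free x) h; exists u; rewrite tder_jac.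
Qed.

(** Both [jac y] and the sign [sgn y] refer to the preferred chart at [y] and may jump. In the fixed
    chart at [x] the normal picks up the factor [\det (J y)], whose sign compensates [sgn y] by
    [osgn_consistent]. Near [x] the unit normal is thus [F], built from derivatives in one chart. *)
Lemma unit_normal_tdiff x : tdiff x (unit_normal o f).
Proof.
pose c := chart_at x; have cx : cdom c x := cdom_at x; pose p := chart c x.
pose D (q : 'rV[R]_d) : 'M[R]_(d, d.+1) :=
  \matrix_k 'D_(delta_mx 0 k) (f \o cinv (m:=S) c) q.
pose J y : 'M[R]_d := \matrix_k tder y (delta_mx 0 k) (chart (m:=S) c).
have jacE y : cdom c y -> jac y = J y *m D (chart c y).
  move=> cy; have df : differentiable (f \o cinv (m:=S) c) (chart c y).
    exact: smooth_on_differentiable f_imm.1 (I : setT y) cy.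
  apply/row_matrixP => k; rewrite row_mul !rowK (tder_chart _ cy df).
  set u := tder y _ _; rewrite {1}[u]row_sum_delta (deriveE _ df) linear_sum
    [RHS]mulmx_sum_row.
  by apply: eq_bigr => l _; rewrite linearZ rowK /= deriveE.
pose F (q : 'rV[R]_d) := (sgn x / Num.sqrt (dot (normal (D q)) (normal (D q)))) *:
  normal (D q).
have Jx : J x = 1%:M.
  by apply/row_matrixP => k; rewrite rowK row1 tder_chart_self.
have nE : \forall y \near x, F (chart c y) = unit_normal o f y.
  have cons := osgn_consistent o cx.
  near=> y; have cy : cdom c y by near: y; exact: near_cdom.
  have sy : 0 < sgn y * \det (J y) * (sgn x * \det (J x)) by near: y.
  rewrite unit_normal_eq /nu jacE // normal_mul dotZl dotZr scalerA.
  rewrite /F; set N := normal _; set q := Num.sqrt (dot N N); congr (_ *: _).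
  rewrite mulrA sqrtrM ?sqr_ge0 -?expr2 ?sqr_ge0 // sqrtr_sqr -/q.
  rewrite Jx det1 mulr1 in sy.
  have dJ : \det (J y) != 0 by apply/eqP => dJ; move: sy; rewrite dJ mulr0 mul0r ltxx.
  (* The right-hand side is positive by consistency of the orientation with [J x = 1], and the signs
     have absolute value 1. *)
  have : `|\det (J y)| = sgn y * \det (J y) * sgn x.
    by rewrite -[RHS]gtr0_norm // !normrM !normr_sign mul1r mulr1.
  move=> ->; have n0 (z : S) : sgn z != 0 by rewrite signr_eq0.
  have bE : (sgn x)^-1 = sgn x by apply: (mulIf (n0 x)); rewrite sgn2 mulVf.
  rewrite !invfM bE; move: q^-1 (sgn x) (sgn y) (\det (J y)) (n0 y) dJ => k b a e an0 en0.
  by field; rewrite an0 en0.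
apply: tdiff_near nE _; rewrite /tdiff -/c -/p.
apply: (@near_eq_differentiable _ _ _ F).
  by near=> q; rewrite /=; have [_ ->] : cdom c (cinv c q) /\ chart c (cinv c q) = q
    by near: q; exact: near_cimg.
have oI : open (chart c @` (cdom c `&` setT)) by apply: open_chart_image; exact: openT.
have Ip : (chart c @` (cdom c `&` setT)) p by exists x.
have dN j : differentiable (fun q => normal (D q) 0 j : R) p.
  have CN : Ck 1 (chart c @` (cdom c `&` setT)) (fun q => normal (D q) 0 j).
    apply: (Ck_ext (f := fun q => cofactor (add_row (D q) 0) ord_max j)) => //.
      by move=> q _; rewrite [RHS]mxE.
    apply: Ck_cofactor => // a b.
    case: (unliftP ord_max a) => [k ->|->].
      apply: (Ck_ext (f := fun q => ('D_(delta_mx 0 k) (f \o cinv (m:=S) c) q) 0 b))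
        => //.
        by move=> q _; rewrite add_row_lift mxE.
      have h := (f_imm.1 c 2).2 (delta_mx 0 k).
      by move: (h : Ck 1 _ _) => /(Ck_rV _ _ oI).1; apply.
    apply: (Ck_ext (f := cst (0 : R))) => //; last exact: Ck_cst.
    by move=> q _; rewrite add_row_max mxE.
  by have [+ _] := CN; apply.
have NN0 : 0 < dot (normal (D p)) (normal (D p)).
  rewrite lt_neqAle dot_ge0 andbT eq_sym; apply/eqP => /dot_eq0 N0.
  have := normal_neq0 (jac_free x); rewrite (jacE _ cx) Jx mul1mx -/p N0 eqxx //.
have dd : differentiable (fun q => dot (normal (D q)) (normal (D q)) : R) p.
  rewrite /dot; have -> : (fun q => \sum_i normal (D q) 0 i * normal (D q) 0 i)
     = \sum_(i < d.+1) (fun q => normal (D q) 0 i * normal (D q) 0 i : R).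
    by apply/funext => q; rewrite fct_sumE.
  by apply: differentiable_sum => i; exact: differentiableM.
have ds : differentiable (fun q => Num.sqrt (dot (normal (D q)) (normal (D q))) : R) p.
  apply: (differentiable_comp (g := @Num.sqrt R) dd); apply/derivable1_diffP.
  exact: (ex_derive (is_derive := is_derive1_sqrt NN0)).
apply: differentiable_rV => j.
have -> : (fun z => F z 0 j) = (fun q => (sgn x * (Num.sqrt (dot (normal (D q))
  (normal (D q))))^-1) * normal (D q) 0 j : R).
  by apply/funext => q; rewrite [LHS]mxE.
apply: differentiableM => //; apply: differentiableM => //.
by apply: differentiableV => //; rewrite sqrtr_eq0 -ltNge.
Unshelve. all: by end_near. Qed.

End UnitNormal.

(** * The primitive and the comparison of its forms with those of [w] *)

Section Primitive.
Variables (R : realType) (d : nat) (S : manifold R d) (r : nat).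
Local Notation n := d.+1.
Variables (A : lieAlgebroid S r) (w : g_morphism n A).
Hypothesis n2 : (2 <= n)%N.
Hypothesis anchor_onto : forall x u, exists a, anchor A x a = u.
Hypothesis w_inj : forall x, injective (w x).
Hypothesis rE : r = (#|pairs n| + d)%N.
Hypothesis good : forall x, lin_inj w x.
Implicit Types (x y : S).

Let f := dev w.

Lemma dev_fixes_all x : fixes w x (f x).
Proof. exact: (dev_fixes n2 anchor_onto rE (@good x)). Qed.

Lemma dev_tder_all x (a : A x) : tder x (anchor A x a) f = w x a (f x).
Proof. exact: (dev_tder n2 anchor_onto rE a (@good x)). Qed.

(** For the converse, the isotropy contains a field with the same linear part as [eta]; both vanish
    at [f x], hence they agree. *)
Lemma isotropyE x eta : isotropy w x eta <-> killing eta /\ eta (f x) = 0.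
Proof.
split=> [[a a0 ->]|[ke e0]]; first by split; [exact: mor_killing | exact: dev_fixes_all].
have [a [a0 al]] := lin_onto anchor_onto rE (@good x) (lin_skew ke).
exists a => //; apply/funext => p.
have ae := dev_fixes_all a0; rewrite wE al in ae; rewrite (linE _ ke) in e0.
rewrite (linE p ke) wE al; congr (_ + _).
by apply: (addrI (f x *m lin eta)); rewrite e0 ae.
Qed.

(** If [w x a] vanishes at [f x], it lies in the isotropy, and injectivity of [w] places [a] itself
    in [ker #]. *)
Lemma dev_immersion : immersion f.
Proof.
split.
  apply: smooth_on_sub (dev_smooth w n2 anchor_onto rE) => x _; exact: good.
move=> x u; have [a <-] := anchor_onto x u; rewrite dev_tder_all => wa0.
have [b b0 wab] : isotropy w x (w x a).
  by apply/isotropyE; split => //; exact: mor_killing.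
by rewrite (w_inj wab).
Qed.

Lemma dev_tdiff_all x : tdiff x f.
Proof. exact: imm_tdiff dev_immersion x. Qed.

Lemma logder_anchorE x (a : A x) : logder_anchor f x (w x a) = anchor A x a.
Proof.
apply: xget_unique => [|u]; first exact: dev_tder_all.
rewrite /= -dev_tder_all => h; apply/eqP; rewrite -subr_eq0; apply/eqP.
apply: (dev_immersion.2 x); rewrite -scaleN1r addrC tder_linear;
  last exact: dev_tdiff_all.
by rewrite h scaleN1r addNr.
Qed.

Lemma dev_primitive : primitive w f.
Proof.
have h1 : (1%:M : 'M[R]_n) *m 1%:M^T = 1%:M by rewrite trmx1 mulmx1.
have h2 : \det (1%:M : 'M[R]_n) = 1 by rewrite det1.
exists (fun x => w x), (Euclidean 0 h1 h2); split; last first.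
  by move=> x a; apply/funext => m; rewrite /Ad /= subr0 trmx1 !mulmx1.
split.
- move=> x a; split; first exact: mor_killing.
  by exists (anchor A x a); rewrite dev_tder_all.
- by move=> X sX m; exact: mor_smooth.
- by move=> x a; exact: logder_anchorE.
- by move=> X Y sX sY x; rewrite /logder_bracket !logder_anchorE mor_bracket.
Qed.

(** Moving [f' x] back by the isometry [l] gives a common zero of the isotropy of [w] at [x], and
    that zero is unique. *)
Lemma primitive_uniq f' : immersion f' -> primitive w f' ->
  exists l : euclidean R n, forall x, f' x = eu_act l (f x).
Proof.
move=> imm' [lam [l [[l1 _ l3 _] lAd]]]; exists l => x.
have RR : (eu_rot l)^T *m eu_rot l = 1%:M by apply: mulmx1C; exact: eu_rot_orth.
have fx : fixes w x ((f' x - eu_transl l) *m (eu_rot l)^T).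
  move=> a a0; have [_ [u hu]] := l1 x a.
  (* The witness [u] from [logder_fib] guarantees that [logder_anchor] is a genuine solution and not
     the default 0. *)
  have tx : tder x (logder_anchor f' x (lam x a)) f' = lam x a (f' x).
    by rewrite /logder_anchor; case: xgetP => [_ _ //|/(_ u)]; case.
  move: tx; rewrite l3 a0 tder0 lAd /Ad => /(congr1 (mulmxr (eu_rot l)^T)) /=.
  by rewrite mul0mx -mulmxA eu_rot_orth mulmx1.
rewrite /eu_act -(fixes_uniq n2 anchor_onto rE (@good x) fx (dev_fixes_all (x := x))).
by rewrite -mulmxA RR mulmx1 subrK.
Qed.

(** Evaluation at [f x] identifies E/h with R^n: subtracting from [xi] its value there leaves a
    Killing field vanishing at [f x], which is isotropy. *)
Lemma const_partE x xi : killing xi -> const_part w x xi = xi (f x).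
Proof.
move=> kx; apply: xget_unique => [|b] /=.
  apply/isotropyE; split; first exact: (killing_sub kx (killing_const (xi (f x)))).
  by rewrite -[LHS]/(xi (f x) - xi (f x)) subrr.
by move=> /isotropyE[_ /eqP]; rewrite -[_ (f x)]/(xi (f x) - b) subr_eq0 => /eqP.
Qed.

Lemma tliftE x u : exists a, anchor A x a = u /\ tlift w x u = w x a.
Proof.
exists (xget 0 [set a | anchor A x a = u]); split => //.
have [a aE] := anchor_onto x u; case: xgetP => [_ _ //|/(_ a)]; case.
exact: aE.
Qed.

Lemma tlift_dev x u : tlift w x u (f x) = tder x u f.
Proof. by have [a [<- ->]] := tliftE x u; rewrite dev_tder_all. Qed.

Lemma killing_tlift x u : killing (tlift w x u).
Proof. by have [a [_ ->]] := tliftE x u; exact: mor_killing. Qed.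

Lemma first_form_dev x u v : first_form_of w x u v = first_form f x u v.
Proof.
by rewrite /first_form_of /quot_inner !const_partE ?tlift_dev //; exact: killing_tlift.
Qed.

(** A tangent constant field differs from some [w x a] by a field vanishing at [f x], which again
    lies in the image of [w]. Orthogonality to the constant fields in A thus becomes orthogonality
    to the tangent space of [f]. *)
Lemma const_mem x (c : 'rV[R]_n) :
  (exists a, w x a = const_field c) <-> exists u, tder x u f = c.
Proof.
split=> [[a wa]|[u uc]]; first by exists (anchor A x a); rewrite dev_tder_all wa.
have [a aE] := anchor_onto x u.
have [b b0 bE] : isotropy w x (w x a - const_field c).
  apply/isotropyE; split.
    exact: (killing_sub (mor_killing w a) (killing_const c)).
  by rewrite -[LHS]/(w x a (f x) - c) -dev_tder_all aE uc subrr.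
by exists (a - b); rewrite linearB /= -bE opprB addrC subrK.
Qed.

Variable o : orientation S.

Lemma is_normal_dev x b : is_normal_of o w x b <-> is_unit_normal o f x b.
Proof.
have E (v : 'I_d -> 'rV[R]_d) : \matrix_(i < n) extend (fun k =>
  tlift w x (v k)) (const_field b) i (f x)
    = \matrix_(i < n) extend (fun k => tder x (v k) f) b i.
  apply/row_matrixP => i; rewrite !rowK.
  transitivity (extend (n := n) (fun k => tlift w x (v k) (f x)) b i).
    exact: (extend_comp (fun F : vfield R n => F (f x))).
  by congr (extend _ _ _); apply/funext => k; rewrite tlift_dev.
split=> -[h1 h2 h3]; split=> //.
- by move=> u; apply: h1; apply/const_mem; exists u.
(* The point in [quot_pos_basis] is existential, but having the isotropy as its stabilizer makes it
   a common zero, hence equal to [f x]. *)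
- move=> v /h3[m [mP]]; suff -> : m = f x by rewrite E.
  apply: (fixes_uniq n2 anchor_onto rE (@good x) _ (dev_fixes_all (x := x))) => a a0.
  by have [|//] := (mP (w x a)).1 _; exists a.
- by move=> c /const_mem[u <-].
- move=> v /h3 pos; exists (f x); rewrite E; split => // eta.
  exact: isotropyE.
Qed.

Lemma normal_dev : normal_of o w = unit_normal o f.
Proof.
apply/funext => x; rewrite /normal_of /unit_normal; congr (xget _ _).
by apply/seteqP; split=> b /is_normal_dev.
Qed.

(* Differentiating [nu . Tf(V) = 0] moves the derivative onto the normal nu. *)
Lemma second_form_dev x u V : smooth_vfield V ->
  second_form o f x u V = second_form_of o w x u (V x).
Proof.
move=> sV; have d0 : (0 < d)%N by [].
have nuP y := unit_normalP o dev_immersion d0 y.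
have dnu := unit_normal_tdiff o dev_immersion d0 x.
rewrite /second_form /second_form_of first_form_dev normal_dev /first_form.
set nu := unit_normal o f in nuP dnu *.
have -> : nabla x u (fun y => const_field (nu y)) = const_field (tder x u nu) by [].
pose W y := tder y (V y) f.
have sW : smooth_on setT W.
  apply/smooth_on_rV => [|j]; first exact: openT.
  apply: (smooth_on_ext (F := fun y => tder y (V y) (fun z => f z 0 j)));
    first exact: openT.
    by move=> y _; rewrite tder_rV //; exact: dev_tdiff_all.
  apply: smooth_on_tder_vfield => //.
  by have /smooth_on_rV -/(_ openT) := dev_immersion.1; exact.
have dW : tdiff x W := smooth_on_tdiff sW (I : setT x).
have dnu0 : dot (tder x u nu) (nu x) = 0.
  have h : tder x u (fun y => dot (nu y) (nu y)) = 0.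
    rewrite -[RHS](tder_cst x u (1 : R)); congr (tder _ _ _).
    by apply/funext => y; have [_ ->] := nuP y.
  move: h; rewrite tder_dot // dotC -mulr2n => /eqP.
  by rewrite mulrn_eq0 /= => /eqP.
(* The derivative of a unit vector is orthogonal to it, hence tangent, so the constant field lies in
   A and [anchor_of] does not return a default. *)
have [a wa] : exists a, w x a = const_field (tder x u nu).
  by apply/const_mem; exact: (orth_unit_normal dev_immersion d0 dnu0).
have -> : tder x (anchor_of w x (const_field (tder x u nu))) f = tder x u nu.
  rewrite dev_tder_all; case: xgetP => [b _ ->//|/(_ a)]; case; exact: wa.
have h : tder x u (fun y => dot (nu y) (W y)) = 0.
  rewrite -[RHS](tder_cst x u (0 : R)); congr (tder _ _ _).
  by apply/funext => y; have [-> _ _] := nuP y.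
move: h; rewrite tder_dot // -/(W x) => /eqP; rewrite addr_eq0 => /eqP.
by rewrite dotC => ->; rewrite [dot (W x) _]dotC.
Qed.

End Primitive.

Theorem theorem1p2 (R : realType) (n : nat) (n_ge2 : (2 <= n)%N)
    (S : manifold R n.-1) (S_sc : simply_connected R S) (o : orientation S)
    (r : nat) (A : lieAlgebroid S r) (rankA : r = ((n + 2) * (n - 1) %/ 2)%N)
    (w : g_morphism n A) (w_imm : inf_immersion w) :
  exists f : S -> 'rV[R]_n,
    [/\ immersion f,
        primitive w f,
        (forall x u v, first_form f x u v = first_form_of w x u v),
        (forall x u V, smooth_vfield V ->
          second_form o f x u V = second_form_of o w x u (V x))
      & (forall f' : S -> 'rV[R]_n, immersion f' -> primitive w f' ->
          exists l : euclidean R n, forall x, f' x = eu_act l (f x))].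
Proof.
(* The identity (n+2)(n-1)/2 = n(n-1)/2 + (n-1), that is, dim so(n) plus the dimension of the
   hypersurface. *)
have rE : r = (#|pairs n| + n.-1)%N.
  rewrite rankA; have := card_pairs n; move: #|pairs n| => N.
  case: n n_ge2 {S S_sc o A rankA w w_imm} => [//|d] _ NE /=.
  rewrite subn1 /= (_ : (d.+1 + 2) * d = (N + d) * 2)%N ?mulnK //.
  by move: NE; rewrite addn2 !mulSn !mulnS; lia.
have [onto inj [x0 [m0 fx0]] _] := w_imm.
have good := good_all n_ge2 onto inj rE S_sc fx0.
(* With [n = d.+1] the dimension [n.-1] computes to [d], the shape in which normals were treated. *)
case: n n_ge2 S S_sc o A rankA w w_imm rE onto inj x0 m0 fx0 good =>
  [//|d] n2 S _ o A _ w _ rE onto inj _ _ _ good.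
exists (dev w); split.
- exact: dev_immersion.
- exact: dev_primitive.
- by move=> x u v; rewrite first_form_dev.
- by move=> x u V; exact: second_form_dev.
- by move=> f'; exact: primitive_uniq.
Qed.
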